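(* Let $P$ be a set of integer pairs, $P_0\subset P$, $P_1=P\setminus P_0$, and $$D=\bigcup_{(i,j)\in P_1}\{(x,y)\in\mathbb{R}^2 : i\le x<i+1,\ j\le y<j+1\}.$$ Let $n,n'>1$ and $p,p'\ge 0$ be integers, and let $f$ be a real function, defined on $\bar D=D\cup\partial D$ and at the points of $P_0$, that is $C^{n+n'}$ on $\bar D$. Suppose that all the terms in the summation formula $$\sum_{(i,j)\in P}f(i,j)=\sum_{(i,j)\in P_0}f(i,j)+A+L+V+R_{np,n'p'}$$ are finite and well-defined, where $A$, $L$, $V$ are given in the context and the remainder term is $$R_{np,n'p'}=\int_D\left(\left(a_p^x+b_{n,p}^x\right)c_{n',p'}^y+\left(a_{p'}^y+b_{n',p'}^y\right)c_{n,p}^x+c_{n,p}^x c_{n',p'}^y\right)f(x,y)\,dx\,dy .$$ Then $$\begin{aligned}|R_{np,n'p'}|\le R^A_{np,n'p'}\equiv{}& T_{n,p}\left((2p'+1)\int_D|f_{n,0}(x,y)|\,dx\,dy+\frac12\int_{\partial D}|f_{n,0}(x,y)\,dx|\right)\\&+T_{n',p'}\left((2p+1)\int_D|f_{0,n'}(x,y)|\,dx\,dy+\frac12\int_{\partial D}|f_{0,n'}(x,y)\,dy|\right)\\&+T_{n,p}\sum_{r=1}^{\lfloor n'/2\rfloor}T_{2r,p'}\int_{\partial D}|f_{n,2r-1}(x,y)\,dx|+T_{n',p'}\sum_{r=1}^{\lfloor n/2\rfloor}T_{2r,p}\int_{\partial D}|f_{2r-1,n'}(x,y)\,dy|\\&+T_{n,p}T_{n',p'}\int_D|f_{n,n'}(x,y)|\,dx\,dy,\end{aligned}$$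 where $f_{\mu,\nu}(x,y)\equiv\dfrac{\partial^{\mu+\nu}}{\partial x^\mu\partial y^\nu}f(x,y)$.
   Context: For integers $s\ge 2$ and $p\ge 0$, $T_{s,p}=\frac{2}{(2\pi)^{s}}\left(\zeta(s)-\sum_{k=1}^{p}\frac{1}{k^{s}}\right)$, where $\zeta$ is the Riemann zeta function. The linear operators in the variable $x$ are $$B_{n,p}^x=-\frac12+\sum_{r=1}^{\lfloor n/2\rfloor}(-1)^{r+1}T_{2r,p}\frac{\partial^{2r-1}}{\partial x^{2r-1}},\qquad a_p^x=\frac{\sin((2p+1)\pi x)}{\sin(\pi x)},$$ $$b_{n,p}^x=\frac{\partial}{\partial x}B_{n,p}^x=-\frac12\frac{\partial}{\partial x}+\sum_{r=1}^{\lfloor n/2\rfloor}(-1)^{r+1}T_{2r,p}\frac{\partial^{2r}}{\partial x^{2r}},\qquad c_{n,p}^x=(-1)^n\left(\sum_{|k|>p}\frac{e^{2\pi \mathrm{i} kx}}{(2\pi \mathrm{i} k)^n}\right)\frac{\partial^n}{\partial x^n},$$ where $a_p^x$ acts by multiplication by the displayed function (extended by continuity, with value $2p+1$ at integers), $\mathrm{i}$ is the imaginary unit, and the sum over $|k|>p$ runs over $k\in\mathbb{Z}$. The operators with superscript $y$ are defined in the same way with $y$ in place of $x$. The other terms of the summation formula are $$A=\int_D a_p^x a_{p'}^y f(x,y)\,dx\,dy,\qquad L=\int_{\partial D}\left(-a_p^x B_{n',p'}^y f(x,y)\,dx+a_{p'}^y B_{n,p}^x f(x,y)\,dy\right),$$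 $$V=\sum_{(i,j)\in\text{vertices of }D} s_{i,j}\,\left(B_{n,p}^x B_{n',p'}^y f\right)(i,j),$$ where $\partial D$ is positively oriented ($D$ on the left), the vertices of $D$ are the points at which $\partial D$ turns, and $s_{i,j}=+1$ if we turn from a vertical to a horizontal direction at $(i,j)$ along $\partial D$, $s_{i,j}=-1$ if we turn from a horizontal to a vertical direction, such that the plus and minus signs appear alternately. $\int_{\partial D}|g\,dx|$ is the integral of $|g|$ with respect to length over the horizontal parts of $\partial D$, and $\int_{\partial D}|g\,dy|$ is the integral of $|g|$ with respect to length over its vertical parts. *)

(* Defs.v *)
From HB Require Import structures.
From mathcomp Require Import all_boot all_order all_algebra.
From mathcomp Require Import all_classical all_reals all_analysis.
From mathcomp Require Import complex.

Set Implicit Arguments.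
Unset Strict Implicit.
Unset Printing Implicit Defensive.
Import Order.TTheory GRing.Theory Num.Theory.
Import numFieldNormedType.Exports.
Local Open Scope classical_set_scope.
Local Open Scope ring_scope.

Section Coefficients.
Context {R : realType}.

(* Riemann's zeta at the integers s >= 2, where the series converges. *)
Definition zeta (s : nat) : R :=
  limn (fun N : nat => \sum_(1 <= k < N) (k%:R ^+ s)^-1 : R).

Definition Tcoef (s p : nat) : R :=
  2 / (2 * pi) ^+ s * (zeta s - \sum_(1 <= k < p.+1) (k%:R ^+ s)^-1).

Definition akernel (p : nat) (x : R) : R :=
  if x \is a Num.int then p.*2.+1%:R
  else sin (p.*2.+1%:R * pi * x) / sin (pi * x).

(* e^(2 pi i k x) / (2 pi i k)^n *)
Definition cterm (n : nat) (x : R) (k : int) : complex R :=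
  let t := 2 * pi * k%:~R in
  (Complex (cos (t * x)) (sin (t * x))) / (Complex 0 t) ^+ n.

(* For n >= 2 the series over |k| > p converges absolutely, so that it may be
   summed symmetrically; the partial sums over p < |k| < N are real numbers, and
   Re only casts them to R. *)
Definition ckernel (n p : nat) (x : R) : R :=
  limn (fun N : nat =>
    complex.Re (\sum_(p.+1 <= k < N) (cterm n x k%:Z + cterm n x (- k%:Z))) : R).

End Coefficients.

Section Domain.
Context {R : realType}.
Implicit Types (Q : set (int * int)) (v : int * int) (D : set (R * R)).

Definition pt v : R * R := (v.1%:~R, v.2%:~R).

Definition domain Q : set (R * R) :=
  \bigcup_(v in Q) [set z : R * R |
    (v.1%:~R <= z.1 < (v.1 + 1)%:~R) && (v.2%:~R <= z.2 < (v.2 + 1)%:~R)].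

(* Boundary edges of the domain, oriented with the domain on the left.  The
   horizontal edge v joins v to v + (1, 0), and the vertical edge v joins v to
   v + (0, 1). *)
Definition rightward Q : set (int * int) :=
  [set v | Q v /\ ~ Q (v.1, v.2 - 1)].
Definition leftward Q : set (int * int) :=
  [set v | Q (v.1, v.2 - 1) /\ ~ Q v].
Definition upward Q : set (int * int) :=
  [set v | Q (v.1 - 1, v.2) /\ ~ Q v].
Definition downward Q : set (int * int) :=
  [set v | Q v /\ ~ Q (v.1 - 1, v.2)].

(* The boundary arrives at v along a vertical edge and leaves v along a
   horizontal one. *)
Definition turn_vh Q : set (int * int) :=
  [set v | (upward Q (v.1, v.2 - 1) \/ downward Q v) /\
           (rightward Q v \/ leftward Q (v.1 - 1, v.2))].
(* The boundary arrives at v along a horizontal edge and leaves v along a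
   vertical one. *)
Definition turn_hv Q : set (int * int) :=
  [set v | (rightward Q (v.1 - 1, v.2) \/ leftward Q v) /\
           (upward Q v \/ downward Q (v.1, v.2 - 1))].

(* A point where two squares of the domain meet only diagonally is passed twice
   by the boundary, with the same turn both times; it occurs here once. *)
Definition vertices Q : set (int * int) := turn_vh Q `|` turn_hv Q.

Definition turn_sign Q v : R :=
  if `[< turn_vh Q v >] then 1 else -1.

(* The integrals of |g dx| and of |g dy| over the boundary. *)
Definition bd_dx Q (g : R * R -> R) : \bar R :=
  (\esum_(v in rightward Q `|` leftward Q)
    \int[lebesgue_measure]_(x in `[v.1%:~R, (v.1 + 1)%:~R])
      `| g (x, v.2%:~R) |%:E)%E.
Definition bd_dy Q (g : R * R -> R) : \bar R :=
  (\esum_(v in upward Q `|` downward Q)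
    \int[lebesgue_measure]_(y in `[v.2%:~R, (v.2 + 1)%:~R])
      `| g (v.1%:~R, y) |%:E)%E.

End Domain.

Notation area R := (@lebesgue_measure R \x @lebesgue_measure R)%E.

Section Derivatives.
Context {R : realType}.
Implicit Types (D : set (R * R)) (g : R * R -> R) (z : R * R).

Definition inner_dx g : R * R -> R := fun z => derive1 (fun t => g (t, z.2)) z.1.
Definition inner_dy g : R * R -> R := fun z => derive1 (fun t => g (z.1, t)) z.2.

(* Partial derivatives on the closure of D: the continuous extension of the
   partial derivatives in the interior of D.  No value of g outside the
   interior is used. *)
Definition pdx D g : R * R -> R :=
  fun z => lim (inner_dx g @ within (interior D) (nbhs z)).
Definition pdy D g : R * R -> R :=
  fun z => lim (inner_dy g @ within (interior D) (nbhs z)).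

(* g is C^k on the closure of D: all partial derivatives of order at most k
   exist in the interior of D and extend continuously to the closure.  The
   filter within D° (nbhs z) contains z when z is interior, so that convergence
   there says that the partial derivative is continuous at z. *)
Fixpoint Ck_closure D (k : nat) g : Prop :=
  {within closure D, continuous g} /\
  if k is k'.+1 then
    [/\ (forall z, interior D z ->
           derivable (fun t => g (t, z.2)) z.1 1 /\
           derivable (fun t => g (z.1, t)) z.2 1),
        (forall z, closure D z ->
           cvg (inner_dx g @ within (interior D) (nbhs z)) /\
           cvg (inner_dy g @ within (interior D) (nbhs z))),
        Ck_closure D k' (pdx D g) &
        Ck_closure D k' (pdy D g)]
  else True.

Definition pderiv D (mu nu : nat) g : R * R -> R :=
  iter mu (pdx D) (iter nu (pdy D) g).

End Derivatives.

(* The operators in one of the two variables, which is given by its coordinate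
   function var and its partial derivative d. *)
Section Operators.
Context {R : realType}.
Implicit Types (var g : R * R -> R) (d : (R * R -> R) -> R * R -> R).

Definition opB d (n p : nat) g : R * R -> R := fun z =>
  - 2^-1 * g z
  + \sum_(1 <= r < (n./2).+1) (-1) ^+ r.+1 * Tcoef r.*2 p * iter (r.*2).-1 d g z.

Definition opa var (p : nat) g : R * R -> R := fun z =>
  akernel p (var z) * g z.

Definition opb d (n p : nat) g : R * R -> R := fun z =>
  - 2^-1 * d g z
  + \sum_(1 <= r < (n./2).+1) (-1) ^+ r.+1 * Tcoef r.*2 p * iter r.*2 d g z.

Definition opc var d (n p : nat) g : R * R -> R := fun z =>
  (-1) ^+ n * ckernel n p (var z) * iter n d g z.

End Operators.

Section Terms.
Context {R : realType}.
Variables (Q : set (int * int)) (n p n' p' : nat) (f : R * R -> R).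

Let D : set (R * R) := domain Q.
Let dx := pdx D.
Let dy := pdy D.
Let X : R * R -> R := fst.
Let Y : R * R -> R := snd.

Definition A_integrand : R * R -> R := opa X p (opa Y p' f).

(* The coefficients of - dx and of dy in the line integral L. *)
Definition L_dx : R * R -> R := opa X p (opB dy n' p' f).
Definition L_dy : R * R -> R := opa Y p' (opB dx n p f).

Definition V_summand (v : int * int) : R :=
  turn_sign Q v * opB dx n p (opB dy n' p' f) (pt v).

Definition R_integrand : R * R -> R := fun z =>
  let cyf := opc Y dy n' p' f in
  let cxf := opc X dx n p f in
  (opa X p cyf z + opb dx n p cyf z) + (opa Y p' cxf z + opb dy n' p' cxf z)
  + opc X dx n p cyf z.

Local Open Scope ereal_scope.

Definition remainder : \bar R := \int[area R]_(z in D) (R_integrand z)%:E.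

Definition remainder_bound : \bar R :=
  let abs_area g := \int[area R]_(z in D) `| g z |%:E in
  let F mu nu := pderiv D mu nu f in
  let T s q : \bar R := (Tcoef s q)%:E in
  T n p * ((p'.*2.+1)%:R%:E * abs_area (F n 0%N)
           + (2^-1)%:E * bd_dx Q (F n 0%N))
  + T n' p' * ((p.*2.+1)%:R%:E * abs_area (F 0%N n')
               + (2^-1)%:E * bd_dy Q (F 0%N n'))
  + T n p * \sum_(1 <= r < (n'./2).+1) T r.*2 p' * bd_dx Q (F n (r.*2).-1)
  + T n' p' * \sum_(1 <= r < (n./2).+1) T r.*2 p * bd_dy Q (F (r.*2).-1 n')
  + T n p * T n' p' * abs_area (F n n').

End Terms.

(* Main.v *)
Require Import Defs.
From HB Require Import structures.
From mathcomp Require Import all_boot all_order all_algebra.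
From mathcomp Require Import all_classical all_reals all_analysis.
From mathcomp Require Import measurable_realfun lebesgue_integral_differentiation.
From mathcomp Require Import complex ring lra zify.
Import Order.TTheory GRing.Theory Num.Theory.
Import numFieldNormedType.Exports.
Local Open Scope classical_set_scope.
Local Open Scope ring_scope.

(** The terms a^x c^y f and c^x c^y f are bounded pointwise, by |a| <= 2p+1 and
    |c_n| <= T_{n,p} |d^n|.  In b^x c^y f the kernel of c^y depends on y only, so
    that this term is the x-derivative of that kernel times B^x f_{0,n'}; its
    integral over a unit square is the difference of two integrals over vertical
    edges, and over D these differences telescope to the boundary.  Since D may
    be unbounded, the edge integrals have to be absolutely summable: when the
    right-hand side is finite, f_{0,n'} and f_{n,n'} are integrable, and the
    inequality sup |g^(j)| <= C (int |g| + int |g^(n)|), j < n, on unit intervals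
    controls the derivatives in between.  The term b^y c^x f is the transpose,
    once the partial derivatives are exchanged by Schwarz's theorem. *)

Set Implicit Arguments.
Unset Strict Implicit.
Unset Printing Implicit Defensive.

(** * Kernels *)

Section Kernels.
Context {R : realType}.
Implicit Types (x : R) (w : nat -> R) (u : nat -> R -> R).

(** Interior edges do not occur in the bound, so the integrals over them have to be controlled by
    area integrals over adjoining squares before anything may cancel. The bound contains the area
    integrals of f_{0,n'} and f_{n,n'}, but none of f_{k,n'} with 0 < k < n, although such
    derivatives occur in B^x and b^x; hence the interpolation inequality, whose constant depends on
    n alone and can therefore be summed over infinitely many squares. Every T_{s,p} with s >= 2 is
    strictly positive, so an infinite area integral makes the bound infinite, and only finite ones
    remain to be treated; infinite boundary integrals cause no difficulty. The factors 1/2 and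
    T_{2r,p} of the boundary terms are the absolute values of the coefficients of B. On the boundary
    a partial derivative is only a limit from the interior, so calculus is done on rows strictly
    between integer heights, with derivatives inside the row and continuity up to its ends; the
    other rows have measure zero. *)

Lemma nneg_series_nondecreasing w : (forall k, 0 <= w k) ->
  {homo series w : m n / (m <= n)%N >-> m <= n}.
Proof. by move=> w0; apply: nondecreasing_series => k _ _; exact: w0. Qed.

Lemma continuous_sum_nat (F : nat -> R -> R) (m n : nat) :
  (forall k, continuous (F k)) -> continuous (fun x => \sum_(m <= k < n) F k x).
Proof.
move=> cF x; elim: n => [|n IH].
  by under eq_fun do rewrite big_geq//; exact: cst_continuous.
have [mn|nm] := leqP m n; last first.
  by under eq_fun do rewrite big_geq//; exact: cst_continuous.
under eq_fun do rewrite big_nat_recr//=.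
by apply: cvgD; [exact: IH|exact: cF].
Qed.

(** * Weierstrass's test for series of continuous functions *)

Section Weierstrass.
Variables (u : nat -> R -> R) (w : nat -> R).
Hypotheses (uw : forall k x, `|u k x| <= w k) (cw : cvgn (series w)).
Hypothesis cu : forall k, continuous (u k).

Let w_ge0 k : 0 <= w k.
Proof. exact: le_trans (uw k 0). Qed.

Lemma Mtest_cvg x : cvgn (series (u ^~ x)).
Proof.
apply: normed_cvg.
exact: (@series_le_cvg R (fun k => `|u k x|) w (fun k => normr_ge0 _) w_ge0 (fun k => uw k x) cw).
Qed.

Lemma Mtest_tail (N M : nat) x : (N <= M)%N ->
  `|series (u ^~ x) M - series (u ^~ x) N| <= limn (series w) - series w N.
Proof.
move=> NM; rewrite sub_series_geq//; apply: le_trans (ler_norm_sum _ _ _) _.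
apply: (@le_trans _ _ (series w M - series w N)).
  by rewrite sub_series_geq//; apply: ler_sum.
apply: lerB => //; apply: nondecreasing_cvgn_le => //.
exact: nneg_series_nondecreasing.
Qed.

Lemma Mtest_dist (N : nat) x :
  `|limn (series (u ^~ x)) - series (u ^~ x) N| <= limn (series w) - series w N.
Proof.
have c : (fun M => `|series (u ^~ x) M - series (u ^~ x) N|) @ \oo -->
    `|limn (series (u ^~ x)) - series (u ^~ x) N|.
  by apply: cvg_norm; apply: cvgB; [exact: Mtest_cvg|exact: cvg_cst].
rewrite -(cvg_lim _ c)//; apply: limr_le; first by apply: cvgP c.
by exists N => // M /= NM; exact: Mtest_tail.
Qed.

Lemma Mtest_bound x : `|limn (series (u ^~ x))| <= limn (series w).
Proof. by have := Mtest_dist 0 x; rewrite !seriesEnat/= !big_geq// !subr0. Qed.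

(** The error is split into three parts of size e / 3. One partial sum serves all points, because
    the tail of [series w] bounds the distance to the limit everywhere at once. *)
Lemma Mtest_continuous : continuous (fun x => limn (series (u ^~ x))).
Proof.
move=> x; apply/cvgrPdist_lt => e e0.
have e3 : 0 < e / 3 by rewrite divr_gt0.
have [N _ HN] := (cvgrPdist_lt _ _).1 cw _ e3.
have {}HN : limn (series w) - series w N < e / 3.
  by apply: le_lt_trans (HN N (leqnn N)); exact: ler_norm.
have cS : {for x, continuous (fun y => series (u ^~ y) N)}.
  have -> : (fun y => series (u ^~ y) N) = (fun y => \sum_(0 <= k < N) u k y).
    by apply/funext => y; rewrite seriesEnat.
  exact: continuous_sum_nat.
have nS := (cvgrPdist_lt _ _).1 cS _ e3.
near=> y.
have Hy : `|series (u ^~ x) N - series (u ^~ y) N| < e / 3.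
  by near: y; exact: nS.
have dx := Mtest_dist N x; have dy := Mtest_dist N y.
have -> : limn (series (u ^~ x)) - limn (series (u ^~ y)) =
   (limn (series (u ^~ x)) - series (u ^~ x) N) +
   ((series (u ^~ x) N - series (u ^~ y) N) +
   - (limn (series (u ^~ y)) - series (u ^~ y) N)) by ring.
apply: le_lt_trans (ler_normD _ _) _.
have := ler_normD (series (u ^~ x) N - series (u ^~ y) N)
  (- (limn (series (u ^~ y)) - series (u ^~ y) N)).
rewrite normrN => H; lra.
Unshelve. all: by end_near.
Qed.

End Weierstrass.

(** Comparison with a telescoping series: for k >= 2, 1/k^s <= 1/(k(k-1)) = 1/(k-1) - 1/k; the term
    k = 1 contributes a further 1. *)
Lemma sum_inv_exp_le (s N : nat) : (1 < s)%N ->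
  \sum_(1 <= k < N.+2) (k%:R ^+ s)^-1 <= 2 - N.+1%:R^-1 :> R.
Proof.
move=> s1; elim: N => [|N IH].
  by rewrite big_nat1 expr1n invr1; lra.
rewrite big_nat_recr//=; apply: le_trans (lerD IH _) _; first exact: lexx.
have N1 : 0 < N.+1%:R :> R by rewrite ltr0n.
have N2 : 1 < N.+2%:R :> R by rewrite ltr1n.
have H : (N.+2%:R ^+ s)^-1 <= (N.+2%:R * N.+1%:R)^-1 :> R.
  rewrite lef_pV2 ?posrE ?exprn_gt0 ?mulr_gt0 ?(lt_trans _ N2)//.
  apply: le_trans (ler_weXn2l (ltW N2) s1); rewrite expr2 ler_pM2l ?(lt_trans _ N2)//.
  by rewrite ler_nat.
have E : (N.+2%:R * N.+1%:R)^-1 = N.+1%:R^-1 - N.+2%:R^-1 :> R.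
    rewrite -natr1; move: N1; set a := N.+1%:R => a0.
  by field; apply/andP; split; apply: lt0r_neq0; lra.
have -> : 2 - N.+2%:R^-1 = 2 - N.+1%:R^-1 + (N.+1%:R^-1 - N.+2%:R^-1) :> R.
  by rewrite addrA subrK.
by rewrite lerD2l -E.
Qed.

Lemma zeta_sum_nondecreasing (s : nat) :
  {homo (fun N => \sum_(1 <= k < N) (k%:R ^+ s)^-1 : R) :
    m n / (m <= n)%N >-> m <= n}.
Proof.
move=> m n mn; have [n1|n1] := leqP n 1.
  by rewrite !big_geq// (leq_trans mn).
have [m1|m1] := leqP m 1.
  by rewrite [leLHS]big_geq//; apply: sumr_ge0 => k _; rewrite invr_ge0 exprn_ge0.
rewrite (@big_cat_nat _ _ _ m 1 n)//=; last exact: ltnW.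
by rewrite lerDl; apply: sumr_ge0 => k _; rewrite invr_ge0 exprn_ge0.
Qed.

Lemma cvg_zeta_sum (s : nat) : (1 < s)%N ->
  cvgn (fun N => \sum_(1 <= k < N) (k%:R ^+ s)^-1 : R).
Proof.
move=> s1; apply: nondecreasing_is_cvgn; first exact: zeta_sum_nondecreasing.
exists 2 => _ [N _ <-].
apply: (@le_trans _ _ (\sum_(1 <= k < N.+2) (k%:R ^+ s)^-1)).
  by apply: zeta_sum_nondecreasing; rewrite -addn2 leq_addr.
apply: le_trans (sum_inv_exp_le N s1) _.
by rewrite gerBl invr_ge0.
Qed.

(* T_{s,p} = sum_(k > p) 2 / (2 pi k)^s. *)
Definition Tterm (s p k : nat) : R :=
  if (p < k)%N then 2 / (2 * pi * k%:R) ^+ s else 0.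

Lemma Tterm_ge0 (s p k : nat) : 0 <= Tterm s p k.
Proof.
rewrite /Tterm; case: ifP => // _.
by rewrite divr_ge0// exprn_ge0// !mulr_ge0// pi_ge0.
Qed.

Lemma series_gt (v : nat -> R) (p N : nat) :
  series (fun k => if (p < k)%N then v k else 0) N = \sum_(p.+1 <= k < N) v k.
Proof. by rewrite seriesEnat/= -big_mkcond/= [RHS](big_nat_widenl _ 0). Qed.

Lemma cvg_Tterm (s p : nat) : (1 < s)%N ->
  series (Tterm s p) @ \oo --> Tcoef s p.
Proof.
move=> s1.
pose S N : R := \sum_(1 <= k < N) (k%:R ^+ s)^-1.
have c : (fun N => 2 / (2 * pi) ^+ s * (S N - S p.+1)) @ \oo --> Tcoef s p.
  by apply: cvgMr; apply: cvgB; [exact: cvg_zeta_sum|exact: cvg_cst].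
(* The zeta sum can be split at [p.+1] only for N > p, so the two sequences agree eventually. *)
apply: cvg_trans c; apply: near_eq_cvg; exists p.+1 => // N /= pN.
rewrite series_gt /S (@big_cat_nat _ _ _ p.+1 1 N)//= addrAC subrr add0r.
rewrite mulr_sumr; apply: eq_bigr => k _.
by rewrite (exprMn _ (2 * pi)) invfM mulrA.
Qed.

Lemma lim_Tterm (s p : nat) : (1 < s)%N -> limn (series (Tterm s p)) = Tcoef s p.
Proof. by move=> s1; apply: cvg_lim => //; exact: cvg_Tterm. Qed.

(** The partial sum up to [p.+2] consists of the single positive term k = p + 1. Strictness matters
    for the infinite case of the bound: a zero factor would turn [+oo] into 0. *)
Lemma Tcoef_gt0 (s p : nat) : (1 < s)%N -> 0 < Tcoef s p :> R.
Proof.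
move=> s1; rewrite -lim_Tterm//.
apply: (@lt_le_trans _ _ (series (Tterm s p) p.+2)).
  rewrite series_gt big_nat1 divr_gt0// exprn_gt0// !mulr_gt0 ?pi_gt0//.
apply: nondecreasing_cvgn_le; last by apply/cvg_ex; exists (Tcoef s p); exact: cvg_Tterm.
by apply: nneg_series_nondecreasing => k; exact: Tterm_ge0.
Qed.

Lemma cterm_norm (n : nat) x (k : int) :
  `|cterm n x k| = (((`|2 * pi * k%:~R| ^+ n)^-1)%:C)%C.
Proof.
rewrite /cterm normrM normfV normrX !normc_def/= cos2Dsin2 sqrtr1 mul1r.
by rewrite expr0n add0r sqrtr_sqr fmorphV rmorphXn.
Qed.

Lemma Re_cterm_le (n : nat) x (k : int) :
  `|complex.Re (cterm n x k)| <= (`|2 * pi * k%:~R| ^+ n)^-1.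
Proof. by rewrite -lecR -(cterm_norm n x); exact: normc_ge_Re. Qed.

Lemma continuous_Re_cterm (n : nat) (k : int) :
  continuous (fun x => complex.Re (cterm n x k)).
Proof.
rewrite /cterm; set t := 2 * pi * _; set c := (_ ^+ n)^-1.
have -> : (fun x => complex.Re (Complex (cos (t * x)) (sin (t * x)) * c)) =
    (fun x => cos (t * x) * complex.Re c - sin (t * x) * complex.Im c).
  by case: c => a b; apply/funext.
have ct : continuous (fun x => t * x) by exact: mulrl_continuous.
move=> x; apply: cvgB; apply: cvgM; try exact: cvg_cst.
- exact: (continuous_comp (ct x) (@continuous_cos R _)).
- exact: (continuous_comp (ct x) (@continuous_sin R _)).
Qed.

(** Padding with zeros for k <= p turns the symmetric sum of [ckernel] into a series starting at 0,
    to which the majorant test applies. *)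
Definition cpair (n p k : nat) x : R :=
  if (p < k)%N then complex.Re (cterm n x k%:Z + cterm n x (- k%:Z)) else 0.

Lemma ckernelE (n p : nat) x :
  ckernel n p x = limn (series (fun k => cpair n p k x)).
Proof.
rewrite /ckernel; congr (lim (_ @ \oo)); apply/funext => N.
by rewrite series_gt raddf_sum.
Qed.

(** Both exponentials have modulus 1, so the pair is at most 2/(2 pi k)^n, which is exactly the k-th
    term of T_{n,p}. This is why |c_n| <= T_{n,p} comes out with constant 1. *)
Lemma cpair_le (n p k : nat) x : `|cpair n p k x| <= Tterm n p k.
Proof.
rewrite /cpair /Tterm; case: ifP => _; last by rewrite normr0.
rewrite raddfD/=; apply: le_trans (ler_normD _ _) _.
apply: le_trans (lerD (Re_cterm_le n x _) (Re_cterm_le n x _)) _.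
rewrite mulrNz mulrN normrN ger0_norm ?mulr_ge0 ?pi_ge0 ?ler0n//.
by rewrite [leRHS]mulr_natl mulr2n.
Qed.

Lemma cpair_continuous (n p k : nat) : continuous (cpair n p k).
Proof.
rewrite /cpair; case: (p < k)%N; last exact: cst_continuous.
have -> : (fun x => complex.Re (cterm n x k%:Z + cterm n x (- k%:Z))) =
   (fun x => complex.Re (cterm n x k%:Z) + complex.Re (cterm n x (- k%:Z))).
  by apply/funext => x; rewrite raddfD.
by move=> x; apply: cvgD; exact: continuous_Re_cterm.
Qed.

Lemma ckernel_le (n p : nat) x : (1 < n)%N -> `|ckernel n p x| <= Tcoef n p.
Proof.
move=> n1; rewrite ckernelE -lim_Tterm//; apply: Mtest_bound.
- exact: cpair_le.
- by apply/cvg_ex; exists (Tcoef n p); exact: cvg_Tterm.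
Qed.

Lemma continuous_ckernel (n p : nat) : (1 < n)%N -> continuous (@ckernel R n p).
Proof.
move=> n1; rewrite (_ : ckernel n p = fun x => limn (series (fun k => cpair n p k x))).
  apply: (@Mtest_continuous (cpair n p) (Tterm n p)).
  - exact: cpair_le.
  - by apply/cvg_ex; exists (Tcoef n p); exact: cvg_Tterm.
  - exact: cpair_continuous.
by apply/funext => x; exact: ckernelE.
Qed.

(** The Dirichlet kernel: sin((2p+1) pi x)/sin(pi x) written as a sum of cosines, from which
    continuity and the bound 2p+1 can be read off. *)
Definition dirichlet (p : nat) x : R :=
  1 + 2 * \sum_(1 <= k < p.+1) cos ((k.*2)%:R * (pi * x)).

(** The induction step is sin(A + y) - sin(A - y) = 2 cos A sin y with y = pi x and A = 2(p+1)y. *)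
Lemma sin_dirichlet (p : nat) x :
  sin (p.*2.+1%:R * pi * x) = sin (pi * x) * dirichlet p x.
Proof.
rewrite /dirichlet -mulrA; set y := pi * x.
elim: p => [|p IH]; first by rewrite big_geq// mulr0 addr0 mulr1 mul1r.
rewrite big_nat_recr//= (mulrDr 2) addrA mulrDr -IH.
have -> : p.+1.*2.+1%:R * y = p.+1.*2%:R * y + y.
  by rewrite -natr1 mulrDl mul1r.
have -> : p.*2.+1%:R * y = p.+1.*2%:R * y - y.
  by rewrite doubleS -[p.*2.+2%:R]natr1 mulrDl mul1r addrK.
rewrite sinD sinB; ring.
Qed.

Lemma dirichlet_le (p : nat) x : `|dirichlet p x| <= p.*2.+1%:R.
Proof.
apply: le_trans (ler_normD _ _) _.
rewrite normr1 normrM ger0_norm// -[p.*2.+1]addn1 natrD [leRHS]addrC lerD2l -mul2n natrM.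
rewrite ler_pM2l//; apply: le_trans (ler_norm_sum _ _ _) _.
apply: (@le_trans _ _ (\sum_(1 <= k < p.+1) 1)).
  by apply: ler_sum => k _; rewrite ler_norml cos_geN1 cos_le1.
by rewrite big_const_nat iter_addr_0 subn1.
Qed.

(** In the middle branch numerator and denominator both vanish, and the quotient is 0 by convention.
    Each branch is measurable and bounded by 2p+1. *)
Lemma akernelE (p : nat) x : akernel p x =
  if x \is a Num.int then p.*2.+1%:R
  else if sin (pi * x) == 0 then 0 else dirichlet p x.
Proof.
rewrite /akernel; case: ifP => // _; rewrite sin_dirichlet.
by case: eqVneq => [->|s0]; rewrite ?mul0r// mulrAC divff// mul1r.
Qed.

Lemma akernel_le (p : nat) x : `|akernel p x| <= p.*2.+1%:R.
Proof.
rewrite akernelE; case: ifP => _; first by rewrite ger0_norm.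
case: ifP => _; first by rewrite normr0.
exact: dirichlet_le.
Qed.

Lemma measurable_akernel (p : nat) : measurable_fun setT (@akernel R p).
Proof.
rewrite (_ : akernel p = fun x => if x \is a Num.int then p.*2.+1%:R
  else if sin (pi * x) == 0 then 0 else dirichlet p x); last first.
  by apply/funext => x; exact: akernelE.
have cpi : continuous (fun x : R => pi * x) by exact: mulrl_continuous.
apply: measurable_fun_ifT => //.
  apply: (@measurable_fun_bool _ _ _ _ true); rewrite setTI.
  apply: countable_measurable; first by move=> t; exact: measurable_set1.
  have -> : (fun x : R => x \is a Num.int) @^-1` [set true] =
      (fun k : int => k%:~R) @` setT.
    apply/seteqP; split => [x /intrP[k ->]|_ [k _ <-]]; first by exists k.
    by rewrite /= intr_int.
  exact/(sub_countable (card_image_le _ _))/countableP.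
apply: measurable_fun_ifT => //.
  apply: measurable_fun_eqr => //; apply: continuous_measurable_fun => x.
  exact: (continuous_comp (cpi x) (@continuous_sin R _)).
apply: continuous_measurable_fun => x.
apply: cvgD; first exact: cvg_cst.
apply: cvgM; first exact: cvg_cst.
apply: (@continuous_sum_nat (fun k x => cos (k.*2%:R * (pi * x)))) => k {}x.
have ck : continuous (fun x : R => k.*2%:R * (pi * x)).
  by move=> y; apply: cvgM; [exact: cvg_cst|exact: cpi].
exact: (continuous_comp (ck x) (@continuous_cos R _)).
Qed.

End Kernels.

(** * Interpolation of derivatives on an interval *)

Section OneVariable.
Context {R : realType}.
Local Notation mu := (@lebesgue_measure R).
Implicit Types (a b x y : R) (h : R -> R) (g : nat -> R -> R).

Definition L1norm a b h : \bar R := (\int[mu]_(x in `[a, b]) `|h x|%:E)%E.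

Lemma L1norm_ge0 a b h : (0 <= L1norm a b h)%E.
Proof. by apply: integral_ge0 => x _; rewrite lee_fin. Qed.

Lemma within_continuous_norm (A : set R) h :
  {within A, continuous h} -> {within A, continuous (fun x => `|h x|)}.
Proof. by move=> ch x; apply: continuous_comp; [exact: ch|exact: norm_continuous]. Qed.

Lemma within_measurable a b h : {within `[a, b], continuous h} ->
  measurable_fun `[a, b] (EFin \o h).
Proof.
by move=> ch; apply/measurable_EFinP; exact: subspace_continuous_measurable_fun.
Qed.

Lemma within_measurable_norm a b h : {within `[a, b], continuous h} ->
  measurable_fun `[a, b] (fun x => `|h x|%:E).
Proof. by move=> ch; apply: within_measurable; exact: within_continuous_norm. Qed.

Lemma FTC2_within h h' a b : a < b ->
  {within `[a, b], continuous h} -> {within `[a, b], continuous h'} ->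
  (forall x, x \in `]a, b[ -> is_derive x 1 h (h' x)) ->
  (\int[mu]_(x in `[a, b]) (h' x)%:E = (h b - h a)%:E)%E.
Proof.
move=> ab ch ch' dh; rewrite EFinB; apply: continuous_FTC2 => //.
- have /(continuous_within_itvP _ ab)[_ ? ?] := ch.
  by split=> // x /dh[].
- by move=> x /dh[? <-]; rewrite derive1E.
Qed.

Lemma increment_le_integral h h' a b : a < b ->
  {within `[a, b], continuous h} -> {within `[a, b], continuous h'} ->
  (forall x, x \in `]a, b[ -> is_derive x 1 h (h' x)) ->
  ((`|h b - h a|)%:E <= L1norm a b h')%E.
Proof.
move=> ab ch ch' dh.
have -> : (`|h b - h a|%:E = `| \int[mu]_(x in `[a, b]) (h' x)%:E |)%E.
  by rewrite (FTC2_within ab ch ch' dh).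
by apply: le_abse_integral => //; exact: within_measurable.
Qed.

Lemma increment_le_integral_sub h h' a b x y : a < b ->
  {within `[a, b], continuous h} -> {within `[a, b], continuous h'} ->
  (forall x, x \in `]a, b[ -> is_derive x 1 h (h' x)) ->
  x \in `[a, b] -> y \in `[a, b] ->
  ((`|h y - h x|)%:E <= L1norm a b h')%E.
Proof.
move=> ab ch ch' dh.
wlog xy : x y / x <= y.
  move=> H; have [/H//|/ltW yx xab yab] := leP x y.
  by rewrite distrC; apply: H.
move=> xab yab; move: xy; rewrite le_eqVlt => /predU1P[->|xy].
  by rewrite subrr normr0 L1norm_ge0.
have sub : `[x, y] `<=` `[a, b].
  by apply: subset_itvScc; rewrite bnd_simp ?(itvP xab) ?(itvP yab).
apply: (@le_trans _ _ (L1norm x y h')%E).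
  have dh' z : z \in `]x, y[ -> is_derive z 1 h (h' z).
    move=> zxy; apply: dh; rewrite in_itv/=; apply/andP; split.
      by apply: (@le_lt_trans _ _ x); rewrite ?(itvP zxy) ?(itvP xab).
    by apply: (@lt_le_trans _ _ y); rewrite ?(itvP zxy) ?(itvP yab).
  exact: (increment_le_integral xy (continuous_subspaceW sub ch)
    (continuous_subspaceW sub ch') dh').
apply: ge0_subset_integral => //; first exact: within_measurable_norm.
Qed.

(** The witness is a minimum point of |h|, found by compactness: the constant |h c| lies below |h|,
    hence below its mean. *)
Lemma exists_le_mean h a b (M : R) : a < b -> {within `[a, b], continuous h} ->
  (L1norm a b h <= M%:E)%E ->
  exists2 x, x \in `[a, b] & `|h x| <= (b - a)^-1 * M.
Proof.
move=> ab ch hM.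
have [c cab cmin] := EVT_min (ltW ab) (within_continuous_norm ch).
exists c => //; rewrite mulrC ler_pdivlMr ?subr_gt0// -lee_fin.
apply: le_trans hM; rewrite EFinM.
have -> : ((b - a)%:E = mu `[a, b])%E.
  by rewrite lebesgue_measure_itv/= lte_fin ab.
rewrite -integral_cst//; apply: ge0_le_integral => //.
- by move=> x _; rewrite lee_fin.
- exact: within_measurable_norm.
Qed.

(** Derivatives in the open segment and continuity up to its ends are what partial derivatives
    extended by limits to the boundary provide. *)
Definition is_jet (n : nat) g a b :=
  (forall k, (k <= n)%N -> {within `[a, b], continuous (g k)}) /\
  (forall k x, (k < n)%N -> x \in `]a, b[ -> is_derive x 1 (g k) (g k.+1 x)).

Lemma is_jet_sub n m g a b a' b' : (m <= n)%N -> a <= a' -> b' <= b ->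
  is_jet n g a b -> is_jet m g a' b'.
Proof.
move=> mn aa' bb' [cg dg]; split=> k.
- move=> km; apply: (continuous_subspaceW _ (cg k (leq_trans km mn))).
  by apply: subset_itvScc; rewrite bnd_simp.
- move=> x km xab; apply: dg; first exact: leq_trans mn.
  by rewrite in_itv/= (le_lt_trans aa') ?(lt_le_trans _ bb') ?(itvP xab).
Qed.

(* Two points in the outer thirds where the k-th derivative is small give, by the
   mean value theorem, a point between them where the (k+1)-st is small. *)
Lemma exists_small_derivative (k : nat) (l : R) : 0 < l ->
  exists2 C, 0 <= C & forall g a (M : R), is_jet k g a (a + l) ->
    (L1norm a (a + l) (g 0%N) <= M%:E)%E ->
    exists2 x, x \in `[a, (a + l)] & `|g k x| <= C * M.
Proof.
elim: k l => [l l0|k IH l l0].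
  exists l^-1; first by rewrite invr_ge0 ltW.
  move=> g a M [cg _] gM.
  have al : a < a + l by rewrite ltrDl.
  have [x xa Hx] := exists_le_mean al (cg 0%N (leqnn _)) gM.
  by exists x => //; move: Hx; rewrite addrAC subrr add0r.
have l3 : 0 < l / 3 by rewrite divr_gt0.
have [C C0 HC] := IH _ l3.
(* The two values differ by at most 2CM, and the two points are at least l/3 apart: 2/(l/3) =
   6/l. *)
exists (6 / l * C); first by rewrite mulr_ge0// divr_ge0// ltW.
move=> g a M jg gM.
have third t : a <= t -> t + l / 3 <= a + l ->
    exists2 x, x \in `[t, (t + l / 3)] & `|g k x| <= C * M.
  move=> at' tl; apply: HC; first exact: is_jet_sub jg.
  apply: le_trans gM; apply: ge0_subset_integral => //.
    by apply: within_measurable_norm; case: jg => + _; exact.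
  by apply: subset_itvScc; rewrite bnd_simp.
have [//||x xa gx] := third a; first lra.
have [||y ya gy] := third (a + 2 * (l / 3)); [lra|lra|].
move: xa ya; rewrite !in_itv/= => /andP[x1 x2] /andP[y1 y2].
have xy : x < y by lra.
have jxy : is_jet k.+1 g x y by apply: is_jet_sub jg => //; lra.
have [c cxy E] := MVT xy (fun z => jxy.2 k z (ltnSn k)) (jxy.1 k (leqnSn k)).
move: cxy; rewrite in_itv/= => /andP[c1 c2].
exists c; first by rewrite in_itv/=; apply/andP; split; lra.
have yx0 : 0 < y - x by rewrite subr_gt0.
have : `|g k.+1 c| * (y - x) <= 2 * (C * M).
  rewrite -[y - x]gtr0_norm// -normrM -E.
  by apply: le_trans (ler_normB _ _) _; lra.
have CM0 : 0 <= C * M by apply: le_trans gx.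
move=> H.
have : `|g k.+1 c| * (l / 3) <= 2 * (C * M).
  by apply: le_trans H; apply: ler_wpM2l => //; lra.
rewrite -ler_pdivlMr// => /le_trans; apply.
rewrite le_eqVlt; apply/orP; left; apply/eqP; field.
by apply: lt0r_neq0.
Qed.

(** The orders are treated downwards from n. Starting at a point where the j-th derivative is small,
    its increment is at most the integral of |g_n| if j + 1 = n, and at most the supremum of the
    next derivative otherwise, since the interval has length 1. *)
Lemma jet_interpolation (n : nat) :
  exists2 C, 0 <= C & forall g a (M : R), is_jet n g a (a + 1) ->
    (L1norm a (a + 1) (g 0%N) <= M%:E)%E ->
    (L1norm a (a + 1) (g n) <= M%:E)%E ->
    forall j x, (j < n)%N -> x \in `[a, (a + 1)] -> `|g j x| <= C * M.
Proof.
(* [i] counts the orders just below n that are already bounded; for [i = 0] no order j qualifies, so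
   the constant 0 starts the induction. *)
suff H i : exists2 C, 0 <= C & forall g a (M : R), is_jet n g a (a + 1) ->
    (L1norm a (a + 1) (g 0%N) <= M%:E)%E ->
    (L1norm a (a + 1) (g n) <= M%:E)%E ->
    forall j x, (n <= j + i)%N -> (j < n)%N -> x \in `[a, (a + 1)] ->
      `|g j x| <= C * M.
  have [C C0 HC] := H n; exists C => // g a M jg g0 gn j x jn.
  by apply: HC => //; rewrite leq_addl.
elim: i => [|i [C C0 HC]].
  by exists 0 => // g a M _ _ _ j x; rewrite addn0 => /leq_ltn_trans/[apply]; rewrite ltnn.
have [D D0 HD] := exists_small_derivative (n - i.+1) (@ltr01 R).
(* [D] accounts for the small value, [C] for the increment by the mean value theorem, and 1 for the
   increment when j + 1 = n. *)
exists (C + 1 + D); first lra.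
move=> g a M jg g0 gn j x nj jn xa.
have M0 : 0 <= M.
  by rewrite -lee_fin (le_trans _ g0)// L1norm_ge0.
have CM := mulr_ge0 C0 M0.
have DM := mulr_ge0 D0 M0.
have [nji|] := leqP n (j + i)%N.
  by apply: le_trans (HC _ _ _ jg g0 gn j x nji jn xa) _; lra.
move=> jin; have ej : j = (n - i.+1)%N by lia.
have [|y ya gy] := HD g a M _ g0.
  by apply: is_jet_sub jg => //; lia.
rewrite -ej in gy.
have a1 : a < a + 1 by rewrite ltrDl.
suff incr : `|g j x - g j y| <= (C + 1) * M.
  have -> : g j x = (g j x - g j y) + g j y by rewrite subrK.
  by apply: le_trans (ler_normD _ _) _; lra.
have [jn1|jn1] := eqVneq j.+1 n.
  apply: (@le_trans _ _ M); last by lra.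
  rewrite -lee_fin; apply: le_trans gn; rewrite -jn1.
  exact: (increment_le_integral_sub a1 (jg.1 j (ltnW jn)) (jg.1 j.+1 jn)
    (fun z => jg.2 j z jn) ya xa).
wlog xy : x y xa ya {gy} / y <= x.
  by move=> H; have [/H|/ltW/H] := leP y x; [|rewrite distrC]; apply.
have dgj z : z \in `]y, x[ -> is_derive z 1 (g j) (g j.+1 z).
  move=> zyx; apply: (jg.2 j z jn).
  move: zyx xa ya; rewrite !in_itv/= => /andP[? ?] /andP[? ?] /andP[? ?].
  by apply/andP; split; lra.
have yxa : `[y, x] `<=` `[a, a + 1].
  by apply: subset_itvScc; rewrite bnd_simp ?(itvP xa) ?(itvP ya).
have [c cxy ->] := MVT_segment xy dgj (continuous_subspaceW yxa (jg.1 j (ltnW jn))).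
move: cxy xa ya; rewrite !in_itv/= => /andP[? ?] /andP[? ?] /andP[? ?].
have gc : `|g j.+1 c| <= C * M.
  have nj1 : (n <= j.+1 + i)%N by rewrite addSnnS.
  have j1n : (j.+1 < n)%N by rewrite ltn_neqAle jn1.
  apply: (HC _ _ _ jg g0 gn _ _ nj1 j1n).
  by rewrite in_itv/=; apply/andP; split; lra.
rewrite normrM (@ger0_norm _ (x - y)) ?subr_ge0//.
apply: (@le_trans _ _ (`|g j.+1 c| * 1)); first by apply: ler_wpM2l => //; lra.
lra.
Qed.

End OneVariable.

(** * Partial derivatives on unit squares *)

Section Squares.
Context {R : realType}.
Implicit Types (v : int * int) (z w : R * R) (Q : set (int * int)).

(** Closed squares carry the continuity, open ones the derivatives, and half-open ones tile
    [domain Q] without overlap. *)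
Definition csq v : set (R * R) := [set z |
  (v.1%:~R <= z.1 <= (v.1 + 1)%:~R) && (v.2%:~R <= z.2 <= (v.2 + 1)%:~R)].
Definition osq v : set (R * R) := [set z |
  (v.1%:~R < z.1 < (v.1 + 1)%:~R) && (v.2%:~R < z.2 < (v.2 + 1)%:~R)].
Definition hsq v : set (R * R) := [set z |
  (v.1%:~R <= z.1 < (v.1 + 1)%:~R) && (v.2%:~R <= z.2 < (v.2 + 1)%:~R)].

Lemma cvg_pair_pt (f1 f2 : R -> R) (t a b : R) :
  f1 @ nbhs t --> a -> f2 @ nbhs t --> b ->
  (fun s => (f1 s, f2 s)) @ nbhs t --> (a, b).
Proof. move=> c1 c2; exact: (cvg_pair c1 c2). Qed.

Lemma cvg_slice_x (a b : R) : (fun t => (t, b)) @ nbhs a --> (a, b).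
Proof. by apply: (@cvg_pair_pt id (fun=> b)); [exact: cvg_id|exact: cvg_cst]. Qed.

Lemma cvg_slice_y (a b : R) : (fun t => (a, t)) @ nbhs b --> (a, b).
Proof. by apply: (@cvg_pair_pt (fun=> a) id); [exact: cvg_cst|exact: cvg_id]. Qed.

Lemma osq_hsq v : osq v `<=` hsq v.
Proof. by move=> z /andP[/andP[/ltW ? ?] /andP[/ltW ? ?]]; apply/andP; split; apply/andP. Qed.

Lemma hsq_csq v : hsq v `<=` csq v.
Proof. by move=> z /andP[/andP[? /ltW ?] /andP[? /ltW ?]]; apply/andP; split; apply/andP. Qed.

Lemma hsq_domain Q v : Q v -> hsq v `<=` domain Q.
Proof. by move=> Qv z vz; exists v. Qed.

Lemma open_osq v : open (osq v).
Proof.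
have -> : osq v = (fst @^-1` `]v.1%:~R, (v.1 + 1)%:~R[) `&`
                  (snd @^-1` `]v.2%:~R, (v.2 + 1)%:~R[).
  apply/seteqP; split=> z /=; rewrite !in_itv/=; first by move=> /andP[].
  by move=> [? ?]; apply/andP.
apply: openI; apply: open_comp; try exact: interval_open.
- by move=> z _; exact: cvg_fst.
- by move=> z _; exact: cvg_snd.
Qed.

Lemma osq_interior Q v : Q v -> osq v `<=` interior (domain Q).
Proof.
move=> Qv z vz; apply: (@filterS _ _ _ (osq v)).
  by apply: subset_trans (hsq_domain Qv); exact: osq_hsq.
by apply: open_nbhs_nbhs; split => //; exact: open_osq.
Qed.

(* The segment from z to the center of the square stays in the open square. *)
Lemma csq_adherent v z (B : set (R * R)) : csq v z -> nbhs z B ->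
  exists2 w, osq v w & B w.
Proof.
move=> vz Bz.
pose c1 : R := v.1%:~R + 2^-1; pose c2 : R := v.2%:~R + 2^-1.
pose w (t : R) : R * R := (z.1 + t * (c1 - z.1), z.2 + t * (c2 - z.2)).
have cw : w @ nbhs 0 --> z.
  have cc (a b : R) : (fun t : R => a + t * (b - a)) @ nbhs 0 --> a.
    rewrite -[X in _ --> X]addr0 -[X in _ --> a + X](mul0r (b - a)).
    by apply: cvgD; [exact: cvg_cst|apply: cvgM; [exact: cvg_id|exact: cvg_cst]].
  rewrite [X in _ --> X]surjective_pairing; exact: (cvg_pair_pt (cc _ _) (cc _ _)).
have /nbhs_ballP[e /= e0 He] := cw _ Bz.
pose t := Num.min (e / 2) 2^-1.
have t0 : 0 < t by rewrite lt_min divr_gt0//= invr_gt0.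
have te : t < e by rewrite gt_min; apply/orP; left; lra.
have t2 : t <= 2^-1 by rewrite ge_min lexx orbT.
exists (w t); last by apply: He; rewrite /ball/= sub0r normrN gtr0_norm.
move: vz => /andP[/andP[a1 a2] /andP[b1 b2]]; rewrite /osq /w /c1 /c2 /=.
rewrite !intrD in a2 b2 *.
by apply/andP; split; apply/andP; split; nra.
Qed.

Lemma csq_closure Q v : Q v -> csq v `<=` closure (domain Q).
Proof.
move=> Qv z vz B Bz; have [w vw Bw] := csq_adherent vz Bz.
by exists w; split => //; apply: (hsq_domain Qv); exact: osq_hsq.
Qed.

(** Properness makes limits along the interior unique, so that the [lim] in [pdx] and [pdy] can be
    computed at boundary points of a square as well. *)
Lemma within_interior_proper Q v z : Q v -> csq v z ->
  ProperFilter (within (interior (domain Q)) (nbhs z)).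
Proof.
move=> Qv vz; apply: Build_ProperFilter_ex => B Bz.
have [w vw Bw] := csq_adherent vz Bz.
by exists w; apply: Bw; exact: (osq_interior Qv vw).
Qed.

End Squares.

(** * Calculus of the partial derivatives extended to the closure, and Schwarz's theorem *)

Section Calculus.
Context {R : realType}.
Implicit Types (D : set (R * R)) (g h : R * R -> R) (z w : R * R).

Lemma lim_within_eq D h h' z : (forall w, interior D w -> h w = h' w) ->
  lim (h @ within (interior D) (nbhs z)) = lim (h' @ within (interior D) (nbhs z)).
Proof.
move=> E; congr (lim _); apply/funext => B; apply/propext; split => H.
- apply: (@filterS _ (nbhs z) _ _ _ _ H) => w Hw iw.
  by rewrite /preimage/= -E//; exact: Hw.
- apply: (@filterS _ (nbhs z) _ _ _ _ H) => w Hw iw.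
  by rewrite /preimage/= E//; exact: Hw.
Qed.

(** Every set of this filter contains z, so h z lies in every ball around the limit. Consequently
    [pdx] and [pdy] are the ordinary partial derivatives at interior points. *)
Lemma lim_within_interior D h z : interior D z ->
  cvg (h @ within (interior D) (nbhs z)) ->
  lim (h @ within (interior D) (nbhs z)) = h z.
Proof.
move=> iz; set l := lim _ => c0.
have c : h @ within (interior D) (nbhs z) --> l := c0.
apply: contrapT => /eqP; rewrite -subr_eq0 -normr_gt0 => lz.
have bl : nbhs l (ball l `|l - h z|) by exact: nbhsx_ballx.
have /nbhs_singleton /(_ iz) := c _ bl.
by rewrite /= /ball/= ltxx.
Qed.

Lemma interior_continuous D g z : interior D z ->
  {within closure D, continuous g} -> {for z, continuous g}.
Proof.
move=> iz cg.
have ic : interior (closure D) z.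
  by apply: (@filterS _ (nbhs z) _ _ _ _ iz); exact: subset_closure.
have := cg z; rewrite /continuous_at -(nbhs_subspace_interior ic); exact.
Qed.

Lemma Ck_continuous D k g : Ck_closure D k g -> {within closure D, continuous g}.
Proof. by case: k => [|k] []. Qed.

Lemma Ck_le D k l g : (l <= k)%N -> Ck_closure D k g -> Ck_closure D l g.
Proof.
elim: l k g => [|l IH] [|k] g //=; first by move=> _ [].
move=> lk [cg [dg lg xg yg]].
exact: (conj cg (And4 dg lg (IH _ _ lk xg) (IH _ _ lk yg))).
Qed.

Lemma Ck_pdx D k g : Ck_closure D k.+1 g -> Ck_closure D k (pdx D g).
Proof. move=> [_ [_ _ ? _]]; assumption. Qed.

Lemma Ck_pdy D k g : Ck_closure D k.+1 g -> Ck_closure D k (pdy D g).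
Proof. move=> [_ [_ _ _ ?]]; assumption. Qed.

Lemma Ck_iter_pdx D k j g : Ck_closure D (j + k) g ->
  Ck_closure D k (iter j (pdx D) g).
Proof.
elim: j k => [//|j IH] k Hg /=; apply: Ck_pdx; apply: IH.
by rewrite addnS.
Qed.

Lemma Ck_iter_pdy D k j g : Ck_closure D (j + k) g ->
  Ck_closure D k (iter j (pdy D) g).
Proof.
elim: j k => [//|j IH] k Hg /=; apply: Ck_pdy; apply: IH.
by rewrite addnS.
Qed.

Lemma is_derive_pdx D k g z : Ck_closure D k.+1 g -> interior D z ->
  is_derive z.1 1 (fun t => g (t, z.2)) (pdx D g z).
Proof.
move=> [_ [dg lg _ _]] iz; split; first exact: (dg z iz).1.
rewrite -derive1E /pdx lim_within_interior//.
by apply: (lg z _).1; apply: subset_closure; exact: interior_subset.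
Qed.

Lemma is_derive_pdy D k g z : Ck_closure D k.+1 g -> interior D z ->
  is_derive z.2 1 (fun t => g (z.1, t)) (pdy D g z).
Proof.
move=> [_ [dg lg _ _]] iz; split; first exact: (dg z iz).2.
rewrite -derive1E /pdy lim_within_interior//.
by apply: (lg z _).2; apply: subset_closure; exact: interior_subset.
Qed.

(** A derivative at an interior point involves only nearby values, which can be taken in the open
    interior, and [pdx] is everywhere defined as a limit of such derivatives. Hence equality of
    functions on the whole plane. *)
Lemma pdx_eq D g h : (forall z, interior D z -> g z = h z) -> pdx D g = pdx D h.
Proof.
move=> E; apply/funext => z; apply: lim_within_eq => w iw.
rewrite /inner_dx !derive1E; apply: near_eq_derive => //.
have cw : (fun t => (t, w.2)) @ nbhs w.1 --> w.
  rewrite [X in _ --> X]surjective_pairing.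
  exact: cvg_slice_x.
have H := (cw _ (open_nbhs_nbhs (conj (@open_interior _ D) iw))).
exact: (@filterS _ (nbhs w.1) _ _ _ (fun t Ht => E _ Ht) H).
Qed.

Lemma pdy_eq D g h : (forall z, interior D z -> g z = h z) -> pdy D g = pdy D h.
Proof.
move=> E; apply/funext => z; apply: lim_within_eq => w iw.
rewrite /inner_dy !derive1E; apply: near_eq_derive => //.
have cw : (fun t => (w.1, t)) @ nbhs w.2 --> w.
  rewrite [X in _ --> X]surjective_pairing.
  exact: cvg_slice_y.
have H := (cw _ (open_nbhs_nbhs (conj (@open_interior _ D) iw))).
exact: (@filterS _ (nbhs w.2) _ _ _ (fun t Ht => E _ Ht) H).
Qed.

(** In the interior [K w.2] is constant along horizontal lines and comes out of the derivative; both
    factors then converge at z, which may lie on the boundary. *)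
Lemma pdx_mul (K : R -> R) Q v k g z (D := domain Q) : continuous K ->
  Ck_closure D k.+1 g -> Q v -> csq v z ->
  pdx D (fun w => K w.2 * g w) z = K z.2 * pdx D g z.
Proof.
move=> cK [_ [dg lg _ _]] Qv vz.
have PF := within_interior_proper Qv vz.
rewrite {1}/pdx (@lim_within_eq _ _ (fun w => K w.2 * inner_dx g w)); last first.
  move=> w iw; rewrite /inner_dx !derive1E /=.
  have := (dg w iw).1 => dgw.
  by have := deriveZ (K w.2) dgw.
apply: cvg_lim => //; apply: cvgM; last exact: (lg z (csq_closure Qv vz)).1.
have cKz : {for z, continuous (fun w : R * R => K w.2)}.
  apply: (@continuous_comp _ _ _ snd K z); last exact: cK.
  exact: cvg_snd.
by apply: cvg_trans cKz; apply: cvg_app; exact: cvg_within.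
Qed.

Lemma pdy_mul (K : R -> R) Q v k g z (D := domain Q) : continuous K ->
  Ck_closure D k.+1 g -> Q v -> csq v z ->
  pdy D (fun w => K w.1 * g w) z = K z.1 * pdy D g z.
Proof.
move=> cK [_ [dg lg _ _]] Qv vz.
have PF := within_interior_proper Qv vz.
rewrite {1}/pdy (@lim_within_eq _ _ (fun w => K w.1 * inner_dy g w)); last first.
  move=> w iw; rewrite /inner_dy !derive1E /=.
  have := (dg w iw).2 => dgw.
  by have := deriveZ (K w.1) dgw.
apply: cvg_lim => //; apply: cvgM; last exact: (lg z (csq_closure Qv vz)).2.
have cKz : {for z, continuous (fun w : R * R => K w.1)}.
  apply: (@continuous_comp _ _ _ fst K z); last exact: cK.
  exact: cvg_fst.
by apply: cvg_trans cKz; apply: cvg_app; exact: cvg_within.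
Qed.

(** The induction consumes the identity in the interior only, but the integrals run over the
    half-open squares, which contain boundary points; hence the statement on D. *)
Lemma iter_pdx_mul (K : R -> R) Q j k g z (D := domain Q) : continuous K ->
  Ck_closure D k g -> (j <= k)%N -> D z ->
  iter j (pdx D) (fun w => K w.2 * g w) z = K z.2 * iter j (pdx D) g z.
Proof.
move=> cK Hg; elim: j z => [//|j IH] z jk [v Qv vz].
rewrite !iterS (@pdx_eq _ _ (fun w => K w.2 * iter j (pdx D) g w)).
  apply: (pdx_mul (k := 0%N) cK _ Qv (hsq_csq vz)).
  by apply: Ck_iter_pdx; rewrite addn1; exact: (Ck_le jk Hg).
by move=> w /interior_subset Dw; apply: IH => //; exact: ltnW.
Qed.

Lemma iter_pdy_mul (K : R -> R) Q j k g z (D := domain Q) : continuous K ->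
  Ck_closure D k g -> (j <= k)%N -> D z ->
  iter j (pdy D) (fun w => K w.1 * g w) z = K z.1 * iter j (pdy D) g z.
Proof.
move=> cK Hg; elim: j z => [//|j IH] z jk [v Qv vz].
rewrite !iterS (@pdy_eq _ _ (fun w => K w.1 * iter j (pdy D) g w)).
  apply: (pdy_mul (k := 0%N) cK _ Qv (hsq_csq vz)).
  by apply: Ck_iter_pdy; rewrite addn1; exact: (Ck_le jk Hg).
by move=> w /interior_subset Dw; apply: IH => //; exact: ltnW.
Qed.

(** Two uses of the mean value theorem: for s |-> g(s, y+d) - g(s, y), then for t |-> gx(s, t). *)
Lemma mean_value_rectangle (g gx gxy : R * R -> R) (x y d : R) : 0 < d ->
  (forall s t, x <= s <= x + d -> y <= t <= y + d ->
     is_derive s 1 (fun s => g (s, t)) (gx (s, t))) ->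
  (forall s t, x <= s <= x + d -> y <= t <= y + d ->
     is_derive t 1 (fun t => gx (s, t)) (gxy (s, t))) ->
  exists s t, [/\ x <= s <= x + d, y <= t <= y + d &
    g (x + d, y + d) - g (x + d, y) - (g (x, y + d) - g (x, y)) =
    gxy (s, t) * d * d].
Proof.
move=> d0 dx dxy.
have yd : y <= y <= y + d by rewrite lexx lerDl ltW.
have yd' : y <= y + d <= y + d by rewrite lexx lerDl ltW.
pose phi s := g (s, y + d) - g (s, y).
have dphi s : x <= s <= x + d ->
    is_derive s 1 phi (gx (s, y + d) - gx (s, y)).
  by move=> xs; apply: is_deriveB; apply: dx.
have [|||s sx E1] := @MVT _ phi (fun s => gx (s, y + d) - gx (s, y)) x (x + d).
- by rewrite ltrDl.
- by move=> s; rewrite in_itv/= => /andP[/ltW a /ltW b]; apply: dphi; rewrite a.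
- apply: derivable_within_continuous => s; rewrite in_itv/= => xs.
  by have [] := dphi s xs.
have {}sx : x <= s <= x + d by move: sx; rewrite in_itv/= => /andP[/ltW -> /ltW ->].
have [|||t ty E2] := @MVT _ (fun t => gx (s, t)) (fun t => gxy (s, t)) y (y + d).
- by rewrite ltrDl.
- by move=> t; rewrite in_itv/= => /andP[/ltW a /ltW b]; apply: dxy; rewrite ?sx ?a.
- apply: derivable_within_continuous => t; rewrite in_itv/= => yt.
  by have [] := dxy s t sx yt.
have {}ty : y <= t <= y + d by move: ty; rewrite in_itv/= => /andP[/ltW -> /ltW ->].
exists s, t; split=> //.
have -> : g (x + d, y + d) - g (x + d, y) - (g (x, y + d) - g (x, y)) =
  phi (x + d) - phi x by [].
by rewrite E1 E2; ring.
Qed.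

Lemma addrB_swap (a b c d : R) : a - b - (c - d) = a - c - (b - d).
Proof. by ring. Qed.

Lemma dist_lt_halves (a b c e : R) :
  `|a - c| < e / 2 -> `|b - c| < e / 2 -> `|a - b| < e.
Proof.
move=> ac bc; have -> : a - b = (a - c) - (b - c) by ring.
by apply: le_lt_trans (ler_normB _ _) _; lra.
Qed.

(** The second difference over a small square is d*d times a value of each mixed derivative, at two
    points of that square. Were the derivatives at z a distance e > 0 apart, continuity would put
    this common quotient within e/2 of both. *)
Lemma schwarz_interior D g z : Ck_closure D 2 g -> interior D z ->
  pdx D (pdy D g) z = pdy D (pdx D g) z.
Proof.
case: z => x y Hg; set z := (x, y) => iz.
have Hx := Ck_pdx Hg; have Hy := Ck_pdy Hg.
have cxy := interior_continuous iz (Ck_continuous (Ck_pdy Hx)).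
have cyx := interior_continuous iz (Ck_continuous (Ck_pdx Hy)).
apply: contrapT => /eqP; rewrite -subr_eq0 -normr_gt0; set e := `|_| => e0.
have e2 : 0 < e / 2 by rewrite divr_gt0.
have nxy := (cvgrPdist_lt _ _).1 cxy _ e2.
have nyx := (cvgrPdist_lt _ _).1 cyx _ e2.
have nD := open_nbhs_nbhs (conj (@open_interior _ D) iz).
have /nbhs_ballP[r /= r0 Hr] := @filterI _ (nbhs z) (nbhs_filter z) _ _ nD
  (@filterI _ (nbhs z) (nbhs_filter z) _ _ (nxy (nbhs_filter z)) (nyx (nbhs_filter z))).
pose d := r / 2; have d0 : 0 < d by rewrite divr_gt0.
have Hsq s t : x <= s <= x + d -> y <= t <= y + d -> ball (x, y) r (s, t).
  move=> /andP[a b] /andP[a' b'].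
  by split; rewrite /ball/= ltr_norml; apply/andP; split; rewrite /d in b b' *; lra.
have [s [t [sx ty E1]]] : exists s t, [/\ x <= s <= x + d, y <= t <= y + d &
    g (x + d, y + d) - g (x + d, y) - (g (x, y + d) - g (x, y)) =
    pdy D (pdx D g) (s, t) * d * d].
  exact: (@mean_value_rectangle g (pdx D g) (pdy D (pdx D g)) x y d d0
    (fun s t sx ty => is_derive_pdx Hg (Hr _ (Hsq s t sx ty)).1)
    (fun s t sx ty => is_derive_pdy Hx (Hr _ (Hsq s t sx ty)).1)).
have [t' [s' [ty' sx' E2]]] : exists t s, [/\ y <= t <= y + d, x <= s <= x + d &
    g (x + d, y + d) - g (x, y + d) - (g (x + d, y) - g (x, y)) =
    pdx D (pdy D g) (s, t) * d * d].
  (* The same lemma with exchanged coordinates; the two second differences agree up to the order of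
     their terms. *)
  exact: (@mean_value_rectangle (fun w => g (w.2, w.1)) (fun w => pdy D g (w.2, w.1))
    (fun w => pdx D (pdy D g) (w.2, w.1)) y x d d0
    (fun t s ty sx => is_derive_pdy Hg (Hr _ (Hsq s t sx ty)).1)
    (fun t s ty sx => is_derive_pdx Hy (Hr _ (Hsq s t sx ty)).1)).
have E : pdy D (pdx D g) (s, t) = pdx D (pdy D g) (s', t').
  apply: (mulIf (lt0r_neq0 d0)); apply: (mulIf (lt0r_neq0 d0)).
  exact: (etrans (esym E1) (etrans (addrB_swap _ _ _ _) E2)).
have [_ [H1 _]] := Hr _ (Hsq _ _ sx ty).
have [_ [_ H2]] := Hr _ (Hsq _ _ sx' ty').
suff : e < e by rewrite ltxx.
exact: (dist_lt_halves H2
  (eq_ind _ (fun q => `|pdy D (pdx D g) z - q| < e / 2) H1 _ E)).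
Qed.

Lemma inner_dxE D k g z : Ck_closure D k.+1 g -> interior D z ->
  inner_dx g z = pdx D g z.
Proof.
move=> Hg iz; rewrite /inner_dx derive1E.
exact: (@derive_val _ _ _ _ _ _ _ (is_derive_pdx Hg iz)).
Qed.

Lemma inner_dyE D k g z : Ck_closure D k.+1 g -> interior D z ->
  inner_dy g z = pdy D g z.
Proof.
move=> Hg iz; rewrite /inner_dy derive1E.
exact: (@derive_val _ _ _ _ _ _ _ (is_derive_pdy Hg iz)).
Qed.

Lemma schwarz D g : Ck_closure D 2 g -> pdx D (pdy D g) = pdy D (pdx D g).
Proof.
move=> Hg; apply/funext => z; apply: lim_within_eq => w iw.
rewrite (inner_dxE (Ck_pdy Hg) iw) (inner_dyE (Ck_pdx Hg) iw).
exact: (schwarz_interior Hg iw).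
Qed.

Lemma pdx_iter_pdy D j g : Ck_closure D j.+1 g ->
  pdx D (iter j (pdy D) g) = iter j (pdy D) (pdx D g).
Proof.
elim: j => [//|j IH] Hg; rewrite !iterS schwarz.
  congr pdy; apply: IH; exact: (Ck_le (leqnSn _) Hg).
by apply: Ck_iter_pdy; rewrite addn2.
Qed.

Lemma iter_pdx_pdy D n j g : Ck_closure D (n + j) g ->
  iter n (pdx D) (iter j (pdy D) g) = iter j (pdy D) (iter n (pdx D) g).
Proof.
elim: n => [|n IH] Hg; first by rewrite [iter 0 _ _]/= [iter 0 _ _]/=; reflexivity.
rewrite iterS IH; last by apply: Ck_le Hg; rewrite addSn.
rewrite pdx_iter_pdy; first reflexivity.
by apply: Ck_iter_pdx; rewrite addnS.
Qed.

End Calculus.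

(** * Integration over unions of unit squares *)

Section PlaneMeasure.
Context {R : realType}.
Local Notation mu := (@lebesgue_measure R).
Implicit Types (v : int * int) (z w : R * R) (Q : set (int * int)) (h : R * R -> R).

(** The sigma-algebra on [R * R] is the product one; an open set belongs to it as a countable union
    of boxes with rational centre and half-width. *)
Lemma open_measurable_plane (U : set (R * R)) : open U -> measurable U.
Proof.
move=> oU.
pose box (q : rat * rat * rat) : set (R * R) :=
  `]ratr q.1.1 - ratr q.2, ratr q.1.1 + ratr q.2[%classic `*`
  `]ratr q.1.2 - ratr q.2, ratr q.1.2 + ratr q.2[%classic.
pose F q := if `[< box q `<=` U >] then box q else set0.
have -> : U = \bigcup_q F q.
  apply/seteqP; split=> [z Uz|z [q _]]; last first.
    by rewrite /F; case: asboolP => [sub /sub|].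
  have /nbhs_ballP[e /= e0 He] := open_nbhs_nbhs (conj oU Uz).
  (* With half-width between e/4 and e/2 and centre within e/4 of z, the box contains z and stays
     within distance 3e/4 of it. *)
  have [r /itvP rE] := rat_in_itvoo (ltac:(lra) : e / 4 < e / 2).
  have [q1 /itvP q1E] := rat_in_itvoo (ltac:(lra) : z.1 - e / 4 < z.1).
  have [q2 /itvP q2E] := rat_in_itvoo (ltac:(lra) : z.2 - e / 4 < z.2).
  have r1 : e / 4 < ratr r by rewrite rE.
  have r2 : ratr r < e / 2 by rewrite rE.
  have a1 : z.1 - e / 4 < ratr q1 by rewrite q1E.
  have a2 : ratr q1 < z.1 by rewrite q1E.
  have b1 : z.2 - e / 4 < ratr q2 by rewrite q2E.
  have b2 : ratr q2 < z.2 by rewrite q2E.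
  have sub : box (q1, q2, r) `<=` U.
    move=> w [/=]; rewrite !in_itv/= => /andP[? ?] /andP[? ?]; apply: He.
    by split; rewrite /ball/= ltr_norml; apply/andP; split; lra.
  exists (q1, q2, r) => //; rewrite /F; case: asboolP => // _.
  by split; rewrite /= in_itv/=; apply/andP; split; lra.
apply: countable_bigcupT_measurable; first exact: countableP.
move=> q; rewrite /F; case: asboolP => // _.
by apply: measurableX; exact: measurable_itv.
Qed.

Lemma csqE v : (csq v : set (R * R)) =
  `[v.1%:~R, (v.1 + 1)%:~R]%classic `*` `[v.2%:~R, (v.2 + 1)%:~R]%classic.
Proof.
apply/seteqP; split=> z /=; rewrite /csq /= !in_itv/=; first by move=> /andP[].
by move=> [? ?]; apply/andP.
Qed.

Lemma measurable_csq v : measurable (csq v : set (R * R)).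
Proof. by rewrite csqE; apply: measurableX; exact: measurable_itv. Qed.

Lemma hsqE v : (hsq v : set (R * R)) =
  `[v.1%:~R, (v.1 + 1)%:~R[%classic `*` `[v.2%:~R, (v.2 + 1)%:~R[%classic.
Proof.
apply/seteqP; split=> z /=; rewrite /hsq /= !in_itv/=; first by move=> /andP[].
by move=> [? ?]; apply/andP.
Qed.

Lemma measurable_hsq v : measurable (hsq v : set (R * R)).
Proof. by rewrite hsqE; apply: measurableX; exact: measurable_itv. Qed.

Lemma within_csq_measurable v h : {within csq v, continuous h} ->
  measurable_fun (csq v) h.
Proof.
move=> /continuousP ch; apply: (measurability _ (RGenOpens.measurableE R)).
move=> _ [_ [a [b ->] <-]].
have oab : open (`]a, b[%classic : set R) by exact: interval_open.
have /open_subspaceP[V oV VD] := ch _ oab.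
rewrite setIC -VD; apply: measurableI; last exact: measurable_csq.
exact: open_measurable_plane.
Qed.

(** The squares of Q are numbered by [pickle], with the empty set at all other indices; this is the
    disjoint sequence that countable additivity asks for. *)
Definition sqcell Q (k : nat) : set (R * R) :=
  if @pickle_inv (int * int)%type k is Some v then
    if `[< Q v >] then hsq v else set0 else set0.

Lemma sqcell_pickle Q v : Q v -> sqcell Q (pickle v) = hsq v.
Proof. by move=> Qv; rewrite /sqcell pickleK_inv; case: asboolP. Qed.

Lemma domain_sqcell Q : domain Q = \bigcup_k sqcell Q k.
Proof.
apply/seteqP; split=> [z [v Qv vz]|z [k _]].
  exists (pickle v); first exact: I.
  by rewrite sqcell_pickle; [exact: vz|exact: Qv].
rewrite /sqcell; case: pickle_inv => // v; case: asboolP => // Qv vz.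
by exists v.
Qed.

Lemma measurable_sqcell Q k : measurable (sqcell Q k).
Proof.
rewrite /sqcell; case: pickle_inv => // v; case: asboolP => // _.
exact: measurable_hsq.
Qed.

Lemma measurable_domain Q : measurable (domain Q : set (R * R)).
Proof.
by rewrite domain_sqcell; apply: bigcup_measurable => k _; exact: measurable_sqcell.
Qed.

Lemma int_floor_unique (i j : int) (x : R) :
  i%:~R <= x < (i + 1)%:~R -> j%:~R <= x < (j + 1)%:~R -> i = j.
Proof.
move=> /andP[a b] /andP[c d].
have : (i%:~R : R) < (j + 1)%:~R by apply: le_lt_trans d.
have : (j%:~R : R) < (i + 1)%:~R by apply: le_lt_trans b.
by rewrite !ltr_int; lia.
Qed.

Lemma hsq_inj v (w : int * int) z : hsq v z -> hsq w z -> v = w.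
Proof.
move=> /andP[a b] /andP[c d].
by rewrite (surjective_pairing v) (surjective_pairing w)
  (int_floor_unique a c) (int_floor_unique b d).
Qed.

Lemma trivIset_sqcell Q : trivIset setT (sqcell Q).
Proof.
move=> k l _ _ [z []]; rewrite /sqcell.
case E : pickle_inv => [v|//]; case: asboolP => // _ vz.
case E' : pickle_inv => [w|//]; case: asboolP => // _ wz.
have Ek := @pickle_invK (int * int)%type k.
have El := @pickle_invK (int * int)%type l.
move: Ek El; rewrite E E' /= => <- <-.
by rewrite (hsq_inj vz wz).
Qed.

Lemma measurable_fun_domain Q h : (forall v, Q v -> measurable_fun (hsq v) h) ->
  measurable_fun (domain Q) h.
Proof.
move=> mh; rewrite domain_sqcell; apply/measurable_fun_bigcup.
  exact: measurable_sqcell.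
move=> k; rewrite /sqcell; case: pickle_inv => [v|]; last exact: measurable_fun_set0.
by case: asboolP => [Qv|_]; [exact: mh|exact: measurable_fun_set0].
Qed.

Local Open Scope ereal_scope.

Lemma ge0_integral_domain Q (f : R * R -> \bar R) :
  measurable_fun (domain Q) f -> (forall z, 0 <= f z) ->
  \int[area R]_(z in domain Q) f z =
  \esum_(v in Q) \int[area R]_(z in hsq v) f z.
Proof.
move=> mf f0.
have mf' : measurable_fun (\bigcup_k sqcell Q k) f by rewrite -domain_sqcell.
rewrite domain_sqcell ge0_integral_bigcup//; last 2 first.
- exact: measurable_sqcell.
- exact: trivIset_sqcell.
rewrite nneseries_esumT; last by move=> k; exact: integral_ge0.
rewrite [RHS](_ : _ = \esum_(v in Q) \int[area R]_(z in sqcell Q (pickle v)) f z).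
  rewrite -(@reindex_esum _ _ _ Q (pickle @` Q) pickle
      (fun k => \int[area R]_(z in sqcell Q k) f z)); last first.
    split=> [v Qv|v w _ _|k [v Qv <-]]; first by exists v.
      exact: (pcan_inj pickleK).
    by exists v.
  rewrite [RHS]esum_mkcond; apply: eq_esum => k _; case: ifPn => //.
  rewrite notin_setE => nQ; rewrite /sqcell.
  case E : pickle_inv => [v|]; last by rewrite integral_set0.
  case: asboolP => [Qv|_]; last by rewrite integral_set0.
  exfalso; apply: nQ; exists v => //.
  by have := @pickle_invK (int * int)%type k; rewrite /ocancel E.
by apply: eq_esum => v Qv; rewrite sqcell_pickle.
Qed.

(** By Tonelli's theorem, taken in the two orders, both sides are the same iterated integral. *)
Lemma ge0_integral_swap (A : set (R * R)) (f : R * R -> \bar R) : measurable A ->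
  measurable_fun A f -> (forall z, A z -> 0 <= f z) ->
  \int[area R]_(z in [set z | A (z.2, z.1)]) f (z.2, z.1) = \int[area R]_(z in A) f z.
Proof.
move=> mA mf f0.
have mf' : measurable_fun setT (f \_ A) by apply/(measurable_restrictT _ mA).
have f'0 z : 0 <= (f \_ A) z by rewrite erestrict_ge0.
rewrite [RHS]integral_mkcond fubini_tonelli1//.
rewrite integral_mkcond fubini_tonelli2.
- by [].
- have -> : (fun z => f (z.2, z.1)) \_ [set z | A (z.2, z.1)] =
      (f \_ A) \o (fun z => (z.2, z.1)).
    by apply/funext => -[x y]; rewrite /= !patchE; congr (if _ then _ else _);
      apply/idP/idP; rewrite !inE.
  by apply: measurableT_comp => //; exact: measurable_swap.
- by move=> z; apply: erestrict_ge0 => w /= Aw; exact: f0.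
Qed.

Lemma integral_swap (A : set (R * R)) (f : R * R -> \bar R) : measurable A ->
  measurable_fun A f ->
  \int[area R]_(z in [set z | A (z.2, z.1)]) f (z.2, z.1) = \int[area R]_(z in A) f z.
Proof.
move=> mA mf; rewrite [RHS]integralE [LHS]integralE; congr (_ - _).
- rewrite -(@ge0_integral_swap A f^\+ mA (measurable_funepos mf)); last first.
    by move=> z _; exact: funepos_ge0.
  by apply: eq_integral => z _; rewrite !funeposE.
- rewrite -(@ge0_integral_swap A f^\- mA (measurable_funeneg mf)); last first.
    by move=> z _; exact: funeneg_ge0.
  by apply: eq_integral => z _; rewrite !funenegE.
Qed.

Lemma ge0_fubini_hsq v (f : R * R -> \bar R) : measurable_fun (hsq v) f ->
  (forall z, 0 <= f z) ->
  \int[area R]_(z in hsq v) f z =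
  \int[mu]_(y in `[v.2%:~R, (v.2 + 1)%:~R[)
    \int[mu]_(x in `[v.1%:~R, (v.1 + 1)%:~R[) f (x, y).
Proof.
move=> mf f0.
rewrite integral_mkcond fubini_tonelli2; last 2 first.
- by apply/(measurable_restrictT _ (measurable_hsq v)).
- by move=> z; apply: erestrict_ge0.
rewrite [RHS]integral_mkcond; apply: eq_integral => y _.
rewrite /fubini_G [in RHS]patchE; case: ifPn => yj.
  rewrite [RHS]integral_mkcond; apply: eq_integral => x _.
  rewrite !patchE hsqE; congr (if _ then _ else _).
  by rewrite in_setX yj andbT.
apply: integral0_eq => x _; rewrite patchE hsqE in_setX/=.
by rewrite (negbTE yj) andbF.
Qed.

Lemma fubini_hsq v (f : R * R -> \bar R) : (area R).-integrable (hsq v) f ->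
  \int[area R]_(z in hsq v) f z =
  \int[mu]_(y in `[v.2%:~R, (v.2 + 1)%:~R[)
    \int[mu]_(x in `[v.1%:~R, (v.1 + 1)%:~R[) f (x, y).
Proof.
move=> fi; have mf := (@integrable_mkcond _ _ _ (area R) (hsq v) f (measurable_hsq v)).1 fi.
rewrite integral_mkcond -integral21_prod_meas1//.
rewrite [RHS]integral_mkcond; apply: eq_integral => y _.
rewrite /fubini_G [in RHS]patchE; case: ifPn => yj.
  rewrite [RHS]integral_mkcond; apply: eq_integral => x _.
  rewrite !patchE hsqE; congr (if _ then _ else _).
  by rewrite in_setX yj andbT.
apply: integral0_eq => x _; rewrite patchE hsqE in_setX/=.
by rewrite (negbTE yj) andbF.
Qed.

End PlaneMeasure.

(** * Telescoping over the squares *)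

Section Telescoping.
Context {R : realType}.
Implicit Types (v : int * int) (Q : set (int * int)) (e : int * int -> R).
Local Open Scope ereal_scope.

Lemma esumZ_le (T : choiceType) (c : R) (A : set T) (a : T -> \bar R) :
  (0 <= c)%R -> (forall i, A i -> 0 <= a i) ->
  \esum_(i in A) (c%:E * a i) <= c%:E * \esum_(i in A) a i.
Proof.
move=> c0 a0; apply: ge_ereal_sup => _ [F [finF FA] <-].
rewrite fsbig_finite//= big_seq -ge0_sume_distrr; last first.
  by move=> i; rewrite in_fset_set// inE => /FA /a0.
rewrite -big_seq lee_wpmul2l ?lee_fin// -fsbig_finite//.
by apply: ereal_sup_ubound; exists F.
Qed.

Lemma esum_subset (T : choiceType) (A B : set T) (a : T -> \bar R) :
  A `<=` B -> (forall i, B i -> 0 <= a i) ->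
  \esum_(i in A) a i <= \esum_(i in B) a i.
Proof.
move=> AB a0; rewrite [leRHS](esumID A)//.
rewrite setIidr// leeDl//; apply: esum_ge0 => i [Bi _]; exact: a0.
Qed.

Let epos e v : \bar R := (Num.max (e v) 0)%:E.
Let eneg e v : \bar R := (Num.max (- e v) 0)%:E.

Let epos_ge0 e v : 0 <= epos e v.
Proof. by rewrite lee_fin le_max lexx orbT. Qed.

Let eneg_ge0 e v : 0 <= eneg e v.
Proof. by rewrite lee_fin le_max lexx orbT. Qed.

Let epos_le e v : epos e v <= `|e v|%:E.
Proof. by rewrite lee_fin ge_max ler_norm normr_ge0. Qed.

Let eneg_le e v : eneg e v <= `|e v|%:E.
Proof. by rewrite lee_fin ge_max -normrN ler_norm normr_ge0. Qed.

(** The vertical edge v is the left side of the square v, and [shiftx v] is its right side. *)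
Definition shiftx v : int * int := (v.1 + 1, v.2)%R.

Lemma shiftx_inj : injective shiftx.
Proof. by move=> [a b] [c d] [] /addIr -> ->. Qed.

Lemma shiftx_image Q v : (shiftx @` Q) v <-> Q (v.1 - 1, v.2)%R.
Proof.
split=> [[[a b] Qw <-]|Qv]; first by rewrite /shiftx/= addrK.
by exists (v.1 - 1, v.2)%R => //; rewrite /shiftx/= subrK; case: (v).
Qed.

(* Summing h^+ + e^+ + (e^- o shift) = h^- + (e^+ o shift) + e^- over the squares
   turns the signed telescoping sum into sums of nonnegative terms. *)
Lemma telescope_le Q (h : R * R -> R) e :
  (area R).-integrable (domain Q) (EFin \o h) ->
  \esum_(v in Q) `|e v|%:E < +oo -> \esum_(v in Q) `|e (shiftx v)|%:E < +oo ->
  (forall v, Q v -> \int[area R]_(z in hsq v) (h z)%:E = (e (shiftx v) - e v)%:E) ->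
  \int[area R]_(z in domain Q) (h z)%:E <=
  \esum_(v in upward Q `|` downward Q) `|e v|%:E.
Proof.
move=> ih fe fes hh.
pose f := EFin \o h.
have mf : measurable_fun (domain Q) f by exact: measurable_int ih.
pose P := \int[area R]_(z in domain Q) f^\+ z.
pose M := \int[area R]_(z in domain Q) f^\- z.
have finP : P \is a fin_num.
  by rewrite /P; have := @integrable_pos_fin_num _ _ _ (area R) (domain Q) (measurable_domain Q) _ ih.
have finM : M \is a fin_num.
  by rewrite /M; have := @integrable_neg_fin_num _ _ _ (area R) (domain Q) (measurable_domain Q) _ ih.
have finE (a : int * int -> \bar R) (b : int * int -> R) :
    (forall v, 0 <= a v) -> (forall v, a v <= `|b v|%:E) ->
    \esum_(v in Q) `|b v|%:E < +oo -> \esum_(v in Q) a v \is a fin_num.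
  move=> a0 ab fb; rewrite ge0_fin_numE; last by apply: esum_ge0 => v _.
  by apply: le_lt_trans fb; apply: le_esum => v _; exact: ab.
pose A := \esum_(v in Q) epos e v.
pose B := \esum_(v in Q) eneg e v.
pose A' := \esum_(v in Q) epos e (shiftx v).
pose B' := \esum_(v in Q) eneg e (shiftx v).
have finA : A \is a fin_num by apply: (finE _ e).
have finB : B \is a fin_num by apply: (finE _ e).
have finA' : A' \is a fin_num by apply: (finE _ (e \o shiftx)) => // v; exact: epos_le.
have finB' : B' \is a fin_num by apply: (finE _ (e \o shiftx)) => // v; exact: eneg_le.
have total : P + (A + B') = M + (A' + B).
  rewrite /P /M !ge0_integral_domain//; try exact: measurable_funepos;
    try exact: measurable_funeneg.
  have p0 v : 0 <= \int[area R]_(z in hsq v) f^\+ z.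
    by apply: integral_ge0 => z _; exact: funepos_ge0.
  have n0 v : 0 <= \int[area R]_(z in hsq v) f^\- z.
    by apply: integral_ge0 => z _; exact: funeneg_ge0.
  rewrite -!esumD//; try by move=> v _; exact: adde_ge0.
  apply: eq_esum => v Qv.
  have ihv : (area R).-integrable (hsq v) f.
    exact: (@integrableS _ _ _ (area R) _ _ _ (measurable_domain Q) (measurable_hsq v) (hsq_domain Qv) ih).
  have := hh v Qv; rewrite integralE.
  have := @integrable_pos_fin_num _ _ _ (area R) (hsq v) (measurable_hsq v) _ ihv.
  have := @integrable_neg_fin_num _ _ _ (area R) (hsq v) (measurable_hsq v) _ ihv.
  rewrite -/f; move: (\int[_]_(_ in _) f^\- _) (\int[_]_(_ in _) f^\+ _).
  move=> [m| |] // [p| |] // _ _ [E].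
  rewrite /epos /eneg -!EFinD; congr (_%:E).
  have -> : (p = m + (e (shiftx v) - e v))%R by rewrite -E addrC subrK.
  have mx (x : R) : (x = Num.max x 0 - Num.max (- x) 0)%R.
    have [x0|/ltW x0] := leP 0%R x.
      by rewrite (elimT max_idPr _) ?subr0 ?oppr_le0.
    by rewrite (elimT max_idPl _) ?sub0r ?opprK ?oppr_ge0.
  by have := mx (e v); have := mx (e (shiftx v)); lra.
pose Up := \esum_(v in upward Q) `|e v|%:E.
pose Dn := \esum_(v in downward Q) `|e v|%:E.
(* A right side of a square of Q either is the left side of another square of Q, and is counted in
   [A], or is an upward edge. *)
have A'_le : A' <= A + Up.
  rewrite /A' -(@esum_image _ _ _ Q shiftx (epos e)); last by move=> v w _ _ /shiftx_inj.
  rewrite (esumID Q)//; apply: leeD.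
    by apply: esum_subset => // v [].
  apply: (@le_trans _ _ (\esum_(v in upward Q) epos e v)).
    by apply: esum_subset => // v [/shiftx_image].
  by apply: le_esum => v _; exact: epos_le.
(* Dually, a left side that is not the right side of a square of Q is a downward edge. *)
have B_le : B <= B' + Dn.
  rewrite /B' -(@esum_image _ _ _ Q shiftx (eneg e)); last by move=> v w _ _ /shiftx_inj.
  rewrite /B (esumID (shiftx @` Q))//; apply: leeD.
    by apply: esum_subset => // v [].
  apply: (@le_trans _ _ (\esum_(v in downward Q) eneg e v)).
    by apply: esum_subset => // v [Qv nQ]; split => // Qv'; apply: nQ; exact/shiftx_image.
  by apply: le_esum => v _; exact: eneg_le.
have UpDn : Up + Dn = \esum_(v in upward Q `|` downward Q) `|e v|%:E.
  rewrite (esumID (upward Q)) => [|v _]; last by rewrite lee_fin.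
  have -> : (upward Q `|` downward Q) `&` upward Q = upward Q.
    by apply/seteqP; split => [v []//|v uv]; split => //; left.
  have -> : (upward Q `|` downward Q) `&` ~` upward Q = downward Q.
    apply/seteqP; split => [v [[uv|//] nuv]|v dv]; first by [].
    by split; [right|case: dv => Qv _ [_ nQv]].
  by [].
rewrite -UpDn integralE -/P -/M.
have Up0 : 0 <= Up by apply: esum_ge0 => v _; rewrite lee_fin.
have Dn0 : 0 <= Dn by apply: esum_ge0 => v _; rewrite lee_fin.
(* The six sums in [total] are finite, so its terms can be moved freely between the two sides. Only
   [Up] and [Dn] may be infinite, and then the inequality is trivial. *)
clearbody P M A B A' B' Up Dn; clear UpDn.
move: finP finM finA finB finA' finB' total A'_le B_le.
move: P M A B A' B' => [p| |] // [m| |] // [a| |] // [b| |] // [a'| |] // [b'| |] //.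
move=> _ _ _ _ _ _.
move: Up Dn Up0 Dn0 => [u| |] // [d| |] // _ _; last 3 first.
- by move=> _ _ _; exact: leey.
- by move=> _ _ _; exact: leey.
- by move=> _ _ _; exact: leey.
rewrite -EFinN -!EFinD !lee_fin => -[]; lra.
Qed.

Lemma telescope Q (h : R * R -> R) e :
  (area R).-integrable (domain Q) (EFin \o h) ->
  \esum_(v in Q) `|e v|%:E < +oo -> \esum_(v in Q) `|e (shiftx v)|%:E < +oo ->
  (forall v, Q v -> \int[area R]_(z in hsq v) (h z)%:E = (e (shiftx v) - e v)%:E) ->
  `| \int[area R]_(z in domain Q) (h z)%:E | <=
  \esum_(v in upward Q `|` downward Q) `|e v|%:E.
Proof.
move=> ih fe fes hh; have [i0|i0] := leP 0 (\int[area R]_(z in domain Q) (h z)%:E).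
  by rewrite gee0_abs//; exact: telescope_le.
rewrite lte0_abs//; have -> : \esum_(v in upward Q `|` downward Q) `|e v|%:E =
    \esum_(v in upward Q `|` downward Q) `|- e v|%:E.
  by apply: eq_esum => v _; rewrite normrN.
have intN (A : set (R * R)) : measurable A -> (area R).-integrable A (EFin \o h) ->
    \int[area R]_(z in A) (- h z)%:E = - \int[area R]_(z in A) (h z)%:E.
  by move=> mA iA; exact: (@integralN _ _ _ (area R) A _ (@integrable_add_def _ _ _ (area R) A mA _ iA)).
rewrite -(intN _ (measurable_domain Q) ih); apply: (@telescope_le Q (fun z => - h z)%R (fun v => - e v)%R).
- exact: (@integrableN _ _ _ (area R) _ _ ih).
- by under eq_esum do rewrite normrN.
- by under eq_esum do rewrite normrN.
- move=> v Qv; have ihv : (area R).-integrable (hsq v) (EFin \o h).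
    exact: (@integrableS _ _ _ (area R) _ _ _ (measurable_domain Q) (measurable_hsq v) (hsq_domain Qv) ih).
  by rewrite (intN _ (measurable_hsq v) ihv) hh// -EFinN opprB opprK addrC.
Qed.

End Telescoping.

(** * Slices of squares *)

Section Rows.
Context {R : realType}.
Local Notation mu := (@lebesgue_measure R).
Implicit Types (v w : int * int) (h : R * R -> R) (x y : R) (Q : set (int * int)).

Lemma slice_x v h y : {within csq v, continuous h} ->
  v.2%:~R <= y <= (v.2 + 1)%:~R ->
  {within `[v.1%:~R, (v.1 + 1)%:~R], continuous (fun x => h (x, y))}.
Proof.
move=> /subspace_continuousP ch yv; apply/subspace_continuousP => x.
rewrite /= in_itv/= => xv.
have xyv : csq v (x, y) by rewrite /csq/= xv yv.
move=> B hB; have := @cvg_slice_x R x y _ (ch _ xyv B hB).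
apply: (@filterS _ (nbhs x)) => t; rewrite /= in_itv/= => Ht tv.
by apply: Ht; rewrite /csq/= tv yv.
Qed.

Lemma slice_y v h x : {within csq v, continuous h} ->
  v.1%:~R <= x <= (v.1 + 1)%:~R ->
  {within `[v.2%:~R, (v.2 + 1)%:~R], continuous (fun y => h (x, y))}.
Proof.
move=> /subspace_continuousP ch xv; apply/subspace_continuousP => y.
rewrite /= in_itv/= => yv.
have xyv : csq v (x, y) by rewrite /csq/= xv yv.
move=> B hB; have := @cvg_slice_y R x y _ (ch _ xyv B hB).
apply: (@filterS _ (nbhs y)) => t; rewrite /= in_itv/= => Ht tv.
by apply: Ht; rewrite /csq/= xv tv.
Qed.

Lemma within_integrable (a b : R) (q : R -> R) : {within `[a, b], continuous q} ->
  mu.-integrable `[a, b] (EFin \o q).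
Proof.
move=> cq; exact: (continuous_compact_integrable (@segment_compact R a b) cq).
Qed.

Lemma L1norm_fin (a b : R) (q : R -> R) : {within `[a, b], continuous q} ->
  L1norm a b q \is a fin_num.
Proof.
move=> /within_integrable/integrableP[_ Hq].
by rewrite ge0_fin_numE ?L1norm_ge0.
Qed.

Lemma L1normZ (a b c : R) (q : R -> R) : {within `[a, b], continuous q} ->
  L1norm a b (fun x => c * q x) = (`|c|%:E * L1norm a b q)%E.
Proof.
move=> cq; rewrite /L1norm -ge0_integralZl_EFin//; last exact: within_measurable_norm.
by apply: eq_integral => x _; rewrite normrM EFinM.
Qed.

Lemma le_L1norm (a b : R) (q r : R -> R) : {within `[a, b], continuous q} ->
  {within `[a, b], continuous r} ->
  (forall x, a < x < b -> `|q x| <= `|r x|) -> (L1norm a b q <= L1norm a b r)%E.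
Proof.
move=> cq cr qr.
have mq : measurable_fun `]a, b[ (fun x => `|q x|%:E).
  apply: measurable_funS (within_measurable_norm cq) => //.
  exact: subset_itv_oo_cc.
have mr : measurable_fun `]a, b[ (fun x => `|r x|%:E).
  apply: measurable_funS (within_measurable_norm cr) => //.
  exact: subset_itv_oo_cc.
rewrite /L1norm (integral_itv_bndoo _ _ mq) (integral_itv_bndoo _ _ mr).
by apply: ge0_le_integral => // x; rewrite /= in_itv/= lee_fin => /qr.
Qed.

Lemma L1norm_le_cst (a b M : R) (q : R -> R) : a <= b ->
  {within `[a, b], continuous q} ->
  (forall x, a < x < b -> `|q x| <= M) -> (L1norm a b q <= (M * (b - a))%:E)%E.
Proof.
move=> ab cq qM.
have mq : measurable_fun `]a, b[ (fun x => `|q x|%:E).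
  apply: measurable_funS (within_measurable_norm cq) => //.
  exact: subset_itv_oo_cc.
move: ab; rewrite le_eqVlt => /predU1P[->|ab].
  by rewrite /L1norm set_itv1 integral_set1 subrr mulr0.
rewrite /L1norm (integral_itv_bndoo _ _ mq).
have -> : ((M * (b - a))%:E = \int[mu]_(x in `]a, b[) (cst M%:E) x)%E.
  by rewrite integral_cst//= lebesgue_measure_itv/= lte_fin ab EFinM.
apply: ge0_le_integral => //.
Qed.

Definition rowL1 v h y : \bar R :=
  L1norm v.1%:~R (v.1 + 1)%:~R (fun x => h (x, y)).

Local Open Scope ereal_scope.

Lemma row_restrict v (f : R * R -> \bar R) y : (v.2%:~R <= y < (v.2 + 1)%:~R)%R ->
  fubini_G mu (f \_ (hsq v)) y =
  \int[mu]_(x in `[v.1%:~R, (v.1 + 1)%:~R[) f (x, y).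
Proof.
move=> yv; rewrite [RHS]integral_mkcond; apply: eq_integral => x _.
rewrite !patchE hsqE; congr (if _ then _ else _).
by rewrite in_setX/= !mem_setE !in_itv/= yv andbT.
Qed.

Lemma row_bndo_bndc v h y : {within csq v, continuous h} ->
  (v.2%:~R <= y <= (v.2 + 1)%:~R)%R ->
  \int[mu]_(x in `[v.1%:~R, (v.1 + 1)%:~R[) `|h (x, y)|%:E = rowL1 v h y.
Proof.
move=> ch yv; apply: integral_itv_bndo_bndc.
apply: measurable_funS (within_measurable_norm (slice_x ch yv)) => //.
exact: subset_itv_co_cc.
Qed.

Lemma csq_measurable_norm v h : {within csq v, continuous h} ->
  measurable_fun (hsq v) (fun z => `|h z|%:E).
Proof.
move=> ch; apply/measurable_EFinP; apply: measurableT_comp => //.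
apply: (measurable_funS (measurable_csq v) (@hsq_csq _ v)).
exact: within_csq_measurable.
Qed.

Lemma row_oo v y : y \in `]v.2%:~R, (v.2 + 1)%:~R[ ->
  (v.2%:~R <= y < (v.2 + 1)%:~R)%R /\ (v.2%:~R <= y <= (v.2 + 1)%:~R)%R.
Proof. by rewrite in_itv/= => /andP[a b]; rewrite !ltW// b. Qed.

Lemma rowL1_measurable v h : {within csq v, continuous h} ->
  measurable_fun (`]v.2%:~R, (v.2 + 1)%:~R[%classic : set R) (rowL1 v h).
Proof.
move=> ch; pose f := fun z : R * R => `|h z|%:E.
have mf : measurable_fun setT (f \_ (hsq v)).
  apply/(measurable_restrictT _ (measurable_hsq v)); exact: csq_measurable_norm.
have f0 z : 0 <= (f \_ (hsq v)) z.
  by apply: erestrict_ge0 => w _; rewrite lee_fin.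
have mG := @measurable_fun_fubini_tonelli_G _ _ _ _ _ mu _ mf f0.
apply: (eq_measurable_fun (fubini_G mu (f \_ (hsq v)))).
  move=> y; rewrite inE /= => /row_oo[y1 y2].
  by rewrite row_restrict// row_bndo_bndc.
exact: (measurable_funTS mG).
Qed.

(** Passing to the open interval of heights removes a null set, and with it the rows on horizontal
    edges, where [xjet] gives no derivative. *)
Lemma integral_hsq_rowL1 v h : {within csq v, continuous h} ->
  \int[area R]_(z in hsq v) `|h z|%:E =
  \int[mu]_(y in `]v.2%:~R, (v.2 + 1)%:~R[) rowL1 v h y.
Proof.
move=> ch; rewrite (@ge0_fubini_hsq R v (fun z => `|h z|%:E) (csq_measurable_norm ch)); last first.
  by move=> z; rewrite lee_fin.
rewrite -(integral_itv_bndoo true true (rowL1_measurable ch)).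
apply: eq_integral => y; rewrite inE/= in_itv/= => /andP[y1 y2].
by rewrite row_bndo_bndc// y1 ltW.
Qed.

Lemma integral_hsq_row v h : {within csq v, continuous h} ->
  (area R).-integrable (hsq v) (EFin \o h) ->
  \int[area R]_(z in hsq v) (h z)%:E =
  \int[mu]_(y in `]v.2%:~R, (v.2 + 1)%:~R[)
    \int[mu]_(x in `[v.1%:~R, (v.1 + 1)%:~R]) (h (x, y))%:E.
Proof.
move=> ch ih; rewrite (fubini_hsq ih).
have E y : (v.2%:~R <= y < (v.2 + 1)%:~R)%R ->
    \int[mu]_(x in `[v.1%:~R, (v.1 + 1)%:~R[) (h (x, y))%:E =
    \int[mu]_(x in `[v.1%:~R, (v.1 + 1)%:~R]) (h (x, y))%:E.
  move=> /andP[y1 y2]; apply: integral_itv_bndo_bndc.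
  have y12 : (v.2%:~R <= y <= (v.2 + 1)%:~R)%R by rewrite y1 ltW.
  apply: measurable_funS (within_measurable (slice_x ch y12)) => //.
  exact: subset_itv_co_cc.
have ih' := (@integrable_mkcond _ _ _ (area R) (hsq v) _ (measurable_hsq v)).1 ih.
have mG := measurable_fubini_G ih'.
have mF : measurable_fun (`]v.2%:~R, (v.2 + 1)%:~R[%classic : set R) (fun y =>
    \int[mu]_(x in `[v.1%:~R, (v.1 + 1)%:~R]) (h (x, y))%:E).
  apply: (eq_measurable_fun (fubini_G mu ((EFin \o h) \_ (hsq v)))).
    by move=> y; rewrite inE /= => /row_oo[y1 y2]; rewrite row_restrict// E.
  exact: (measurable_funTS mG).
rewrite -(integral_itv_bndoo true true mF).
by apply: eq_integral => y; rewrite inE/= in_itv/= => /E.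
Qed.

End Rows.

(** * Interpolation applied to the rows of a square *)

Section Jets.
Context {R : realType}.
Local Notation mu := (@lebesgue_measure R).
Implicit Types (v w : int * int) (h : R * R -> R) (x y : R) (Q : set (int * int)).
Implicit Types (g : nat -> R * R -> R).

Definition xjet Q (n : nat) g : Prop :=
  (forall v k, Q v -> (k <= n)%N -> {within csq v, continuous (g k)}) /\
  (forall v k z, Q v -> (k < n)%N -> osq v z ->
     is_derive z.1 1 (fun t => g k (t, z.2)) (g k.+1 z)).

Definition rowW (u0 u1 : R * R -> R) v y : \bar R := (rowL1 v u0 y + rowL1 v u1 y)%E.

Lemma rowW_ge0 u0 u1 v y : (0 <= rowW u0 u1 v y)%E.
Proof. by rewrite adde_ge0// L1norm_ge0. Qed.

Lemma xjet_row Q n g v y : xjet Q n g -> Q v -> y \in `]v.2%:~R, (v.2 + 1)%:~R[ ->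
  is_jet n (fun k x => g k (x, y)) v.1%:~R (v.1 + 1)%:~R.
Proof.
move=> [cg dg] Qv yv; have [_ yv2] := row_oo yv; split=> k.
  move=> kn; exact: (slice_x (cg v k Qv kn) yv2).
move=> x kn; rewrite in_itv/= => xv.
apply: (dg v k (x, y) Qv kn); rewrite /osq/= xv.
by move: yv; rewrite in_itv.
Qed.

(** All rows have length 1, so one constant, chosen before the square and the row, serves them all;
    this uniformity makes the later sum over infinitely many squares finite. *)
Lemma xjet_bound (n : nat) : exists2 C : R, 0 <= C &
  forall Q g v y, xjet Q n g -> Q v -> y \in `]v.2%:~R, (v.2 + 1)%:~R[ ->
  forall k, (k < n)%N ->
    (forall x, v.1%:~R <= x <= (v.1 + 1)%:~R ->
       (`|g k (x, y)|%:E <= C%:E * rowW (g 0%N) (g n) v y)%E) /\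
    (rowL1 v (g k.+1) y <= C%:E * rowW (g 0%N) (g n) v y)%E.
Proof.
have [C C0 HC] := jet_interpolation (R := R) n.
(* [C] serves the orders below n; the extra 1 covers the integral of |g_n|, for which there is no
   supremum bound. *)
exists (C + 1); first by rewrite addr_ge0.
move=> Q g v y jg Qv yv k kn.
have jr := xjet_row jg Qv yv.
have f0 := L1norm_fin (jr.1 0%N (leq0n n)).
have fn := L1norm_fin (jr.1 n (leqnn n)).
pose M := fine (rowW (g 0%N) (g n) v y).
have EM : rowW (g 0%N) (g n) v y = M%:E by rewrite /M fineK// fin_numD; apply/andP.
have M0 : 0 <= M by rewrite -lee_fin -EM rowW_ge0.
have l0 : (rowL1 v (g 0%N) y <= M%:E)%E by rewrite -EM leeDl// L1norm_ge0.
have ln : (rowL1 v (g n) y <= M%:E)%E by rewrite -EM leeDr// L1norm_ge0.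
have H j x : (j < n)%N -> v.1%:~R <= x <= (v.1 + 1)%:~R -> `|g j (x, y)| <= C * M.
  move=> jn xv; move: jr l0 ln; rewrite /rowL1 intrD => jr l0 ln.
  apply: (HC _ _ _ jr l0 ln j x jn); rewrite in_itv/=.
  by move: xv; rewrite intrD.
rewrite EM -EFinM; split=> [x xv|].
  by rewrite lee_fin; apply: le_trans (H _ _ kn xv) _; rewrite ler_wpM2r// lerDl.
have [kn1|kn1] := eqVneq k.+1 n.
  rewrite kn1; apply: le_trans ln _; rewrite lee_fin mulrDl mul1r lerDr.
  exact: mulr_ge0.
have k1n : (k.+1 < n)%N by rewrite ltn_neqAle kn1.
have vv : v.1%:~R <= (v.1 + 1)%:~R :> R by rewrite ler_int; lia.
have v1 : (v.1 + 1)%:~R - v.1%:~R = 1 :> R by rewrite intrD addrAC subrr add0r.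
apply: (@le_trans _ _ (C * M * ((v.1 + 1)%:~R - v.1%:~R))%:E).
  apply: (L1norm_le_cst vv (jr.1 k.+1 kn)) => x /andP[x1 x2].
  by apply: (H _ _ k1n); rewrite !ltW.
by rewrite v1 mulr1 lee_fin ler_wpM2r// lerDl.
Qed.

End Jets.

(** * Divergence theorem in one variable *)

Lemma within_continuousM {R : realType} (U : topologicalType) (A : set U) (q r : U -> R) :
  {within A, continuous q} -> {within A, continuous r} ->
  {within A, continuous (fun x => q x * r x)}.
Proof.
move=> /subspace_continuousP cq /subspace_continuousP cr.
apply/subspace_continuousP => x Ax.
by apply: cvgM; [exact: cq|exact: cr].
Qed.

Lemma left_edge {R : realType} (k : int) : k%:~R <= (k%:~R : R) <= (k + 1)%:~R.
Proof. by rewrite lexx ler_int; lia. Qed.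

Lemma right_edge {R : realType} (k : int) : k%:~R <= ((k + 1)%:~R : R) <= (k + 1)%:~R.
Proof. by rewrite lexx andbT ler_int; lia. Qed.

Section Divergence.
Context {R : realType}.
Local Notation mu := (@lebesgue_measure R).
Implicit Types (v w : int * int) (x y : R).
Variables (Q : set (int * int)) (K : R -> R) (T C : R).
(** H is the x-derivative of G; u0 and u1 have finite area integrals and dominate G and H row by
    row. For b^x c^y f they are f_{0,n'} and f_{n,n'}. *)
Variables (G H u0 u1 : R * R -> R).
Hypotheses (cK : continuous K) (KT : forall y, `|K y| <= T).
Hypotheses (T0 : 0 <= T) (C0 : 0 <= C).
Hypothesis cG : forall v, Q v -> {within csq v, continuous G}.
Hypothesis cH : forall v, Q v -> {within csq v, continuous H}.
Hypothesis cu0 : forall v, Q v -> {within csq v, continuous u0}.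
Hypothesis cu1 : forall v, Q v -> {within csq v, continuous u1}.
Hypothesis dG : forall v z, Q v -> osq v z ->
  is_derive z.1 1 (fun t => G (t, z.2)) (H z).
Hypothesis bG : forall v x y, Q v -> y \in `]v.2%:~R, (v.2 + 1)%:~R[ ->
  v.1%:~R <= x <= (v.1 + 1)%:~R -> (`|G (x, y)|%:E <= C%:E * rowW u0 u1 v y)%E.
Hypothesis bH : forall v y, Q v -> y \in `]v.2%:~R, (v.2 + 1)%:~R[ ->
  (rowL1 v H y <= C%:E * rowW u0 u1 v y)%E.
Local Open Scope ereal_scope.
Hypothesis fu0 : \int[area R]_(z in domain Q) `|u0 z|%:E < +oo.
Hypothesis fu1 : \int[area R]_(z in domain Q) `|u1 z|%:E < +oo.

Let KH (z : R * R) : R := (K z.2 * H z)%R.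

Let cKH v : Q v -> {within csq v, continuous KH}.
Proof.
move=> Qv; apply: within_continuousM (cH Qv); apply: continuous_subspaceT => z.
by apply: (@continuous_comp _ _ _ snd K z); [exact: cvg_snd|exact: cK].
Qed.

Let S v := \int[area R]_(z in hsq v) `|u0 z|%:E + \int[area R]_(z in hsq v) `|u1 z|%:E.

Let S_ge0 v : 0 <= S v.
Proof. by apply: adde_ge0; apply: integral_ge0 => z _; rewrite lee_fin. Qed.

Let measurable_rowW v : Q v ->
  measurable_fun (`]v.2%:~R, (v.2 + 1)%:~R[%classic : set R) (rowW u0 u1 v).
Proof.
move=> Qv; apply: emeasurable_funD; apply: rowL1_measurable; [exact: cu0|exact: cu1].
Qed.

Let integral_rowW v : Q v -> \int[mu]_(y in `]v.2%:~R, (v.2 + 1)%:~R[) rowW u0 u1 v y = S v.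
Proof.
move=> Qv; rewrite /S (integral_hsq_rowL1 (cu0 Qv)) (integral_hsq_rowL1 (cu1 Qv)).
rewrite -ge0_integralD//; try by move=> y _; exact: L1norm_ge0.
- exact: (rowL1_measurable (cu0 Qv)).
- exact: (rowL1_measurable (cu1 Qv)).
Qed.

Let integral_rowWZ v (c : R) : Q v -> (0 <= c)%R ->
  \int[mu]_(y in `]v.2%:~R, (v.2 + 1)%:~R[) (c%:E * rowW u0 u1 v y) = c%:E * S v.
Proof.
move=> Qv c0; rewrite ge0_integralZl_EFin//; first by rewrite integral_rowW.
- by move=> y _; exact: rowW_ge0.
- exact: measurable_rowW.
Qed.

Let sum_S : \esum_(v in Q) S v < +oo.
Proof.
have m0 : measurable_fun (domain Q) (fun z => `|u0 z|%:E).
  apply/measurable_EFinP; apply: measurable_fun_domain => v Qv.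
  by apply/measurable_EFinP; exact: (csq_measurable_norm (cu0 Qv)).
have m1 : measurable_fun (domain Q) (fun z => `|u1 z|%:E).
  apply/measurable_EFinP; apply: measurable_fun_domain => v Qv.
  by apply/measurable_EFinP; exact: (csq_measurable_norm (cu1 Qv)).
have E0 := ge0_integral_domain m0 (fun z => (normr_ge0 (u0 z) : 0 <= `|u0 z|%:E)).
have E1 := ge0_integral_domain m1 (fun z => (normr_ge0 (u1 z) : 0 <= `|u1 z|%:E)).
rewrite /S esumD; last 2 first.
- by move=> v _; apply: integral_ge0 => z _; rewrite lee_fin.
- by move=> v _; apply: integral_ge0 => z _; rewrite lee_fin.
by rewrite -E0 -E1 lte_add_pinfty.
Qed.

Let sum_ZS (a : int * int -> \bar R) (c : R) : (0 <= c)%R ->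
  (forall v, Q v -> a v <= c%:E * S v) -> \esum_(v in Q) a v < +oo.
Proof.
move=> c0 aS; apply: (@le_lt_trans _ _ (c%:E * \esum_(v in Q) S v)).
  apply: le_trans (esumZ_le c0 (fun v _ => S_ge0 v)).
  by apply: le_esum.
by apply: lte_mul_pinfty; rewrite ?lee_fin//; exact: sum_S.
Qed.

Let KH_le v : Q v -> \int[area R]_(z in hsq v) `|KH z|%:E <= (T * C)%:E * S v.
Proof.
move=> Qv; rewrite (integral_hsq_rowL1 (cKH Qv)) -(integral_rowWZ Qv) ?mulr_ge0//.
apply: ge0_le_integral => //.
- by move=> y _; exact: L1norm_ge0.
- exact: (rowL1_measurable (cKH Qv)).
- apply: measurable_funeM; exact: measurable_rowW.
- move=> y yv; have [_ yv2] := row_oo yv.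
  rewrite /rowL1 /KH/= (L1normZ _ (slice_x (cH Qv) yv2)) EFinM -muleA.
  apply: lee_pmul; [by rewrite lee_fin|exact: L1norm_ge0|by rewrite lee_fin|].
  exact: bH.
Qed.

Lemma divergence_integrable : (area R).-integrable (domain Q) (EFin \o KH).
Proof.
have m : measurable_fun (domain Q) KH.
  apply: measurable_fun_domain => v Qv.
  apply: (measurable_funS (measurable_csq v) (@hsq_csq _ v)).
  exact: (within_csq_measurable (cKH Qv)).
apply/integrableP; split; first exact/measurable_EFinP.
have mN : measurable_fun (domain Q) (fun z => `|KH z|%:E).
  by apply/measurable_EFinP; apply: measurableT_comp.
have -> : \int[area R]_(z in domain Q) `|(EFin \o KH) z| =
    \int[area R]_(z in domain Q) `|KH z|%:E by [].
rewrite (ge0_integral_domain mN (fun z => (normr_ge0 (KH z) : 0 <= `|KH z|%:E))).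
exact: (sum_ZS (mulr_ge0 T0 C0) KH_le).
Qed.

Let E (a b x : R) : \bar R := \int[mu]_(y in `[a, b]) (K y * G (x, y))%:E.
(** The flux of K G through the left side of the square v. For the edges of squares of Q this
    integral is finite, so [fine] keeps its value. *)
Let e v : R := fine (E v.2%:~R (v.2 + 1)%:~R v.1%:~R).

Let cKG v x : Q v -> (v.1%:~R <= x <= (v.1 + 1)%:~R)%R ->
  {within `[v.2%:~R, (v.2 + 1)%:~R], continuous (fun y => K y * G (x, y))%R}.
Proof.
move=> Qv xv; apply: within_continuousM (slice_y (cG Qv) xv).
exact: (continuous_subspaceT cK).
Qed.

Let E_fin v x : Q v -> (v.1%:~R <= x <= (v.1 + 1)%:~R)%R ->
  E v.2%:~R (v.2 + 1)%:~R x \is a fin_num.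
Proof.
by move=> Qv xv; apply: integrable_fin_num => //; exact: (within_integrable (cKG Qv xv)).
Qed.

Let E_le v x : Q v -> (v.1%:~R <= x <= (v.1 + 1)%:~R)%R ->
  `|fine (E v.2%:~R (v.2 + 1)%:~R x)|%:E <=
  L1norm v.2%:~R (v.2 + 1)%:~R (fun y => K y * G (x, y))%R.
Proof.
move=> Qv xv.
have -> : `|fine (E v.2%:~R (v.2 + 1)%:~R x)|%:E = `|E v.2%:~R (v.2 + 1)%:~R x|.
  by rewrite -[in RHS](fineK (E_fin Qv xv)).
apply: le_abse_integral => //; exact: (within_measurable (cKG Qv xv)).
Qed.

Let E_le_T v x : Q v -> (v.1%:~R <= x <= (v.1 + 1)%:~R)%R ->
  `|fine (E v.2%:~R (v.2 + 1)%:~R x)|%:E <=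
  T%:E * L1norm v.2%:~R (v.2 + 1)%:~R (fun y => G (x, y)).
Proof.
move=> Qv xv; apply: (le_trans (E_le Qv xv)).
have cGx := slice_y (cG Qv) xv.
rewrite -[T in leRHS]ger0_norm// -(L1normZ T cGx).
apply: (le_L1norm (cKG Qv xv)).
  apply: within_continuousM cGx; apply: continuous_subspaceT => y.
  exact: cst_continuous.
by move=> y _; rewrite !normrM (ger0_norm T0) ler_wpM2r.
Qed.

(** The bound [bG] is uniform along a row, so integrating it over the heights bounds the flux by the
    mass of the adjoining square. This gives the summability over all edges; the final constant
    comes from [E_le_T]. *)
Let E_le_S v x : Q v -> (v.1%:~R <= x <= (v.1 + 1)%:~R)%R ->
  `|fine (E v.2%:~R (v.2 + 1)%:~R x)|%:E <= (T * C)%:E * S v.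
Proof.
move=> Qv xv; apply: (le_trans (E_le Qv xv)).
rewrite -(integral_rowWZ Qv) ?mulr_ge0//.
have mE : measurable_fun (`]v.2%:~R, (v.2 + 1)%:~R[%classic : set R)
    (fun y => `|K y * G (x, y)|%:E).
  apply: measurable_funS (within_measurable_norm (cKG Qv xv)) => //.
  exact: subset_itv_oo_cc.
rewrite /L1norm (integral_itv_bndoo _ _ mE).
apply: ge0_le_integral => //.
- apply: measurable_funeM; exact: measurable_rowW.
- move=> y yv; rewrite normrM !EFinM -muleA.
  apply: lee_pmul; [by rewrite lee_fin|by rewrite lee_fin|by rewrite lee_fin|].
  exact: bG.
Qed.

(** Fubini's theorem, then the fundamental theorem of calculus on each row, where K y is constant
    and leaves the inner integral. *)
Let e_diff v : Q v -> \int[area R]_(z in hsq v) (KH z)%:E = (e (shiftx v) - e v)%:E.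
Proof.
move=> Qv.
have iKH : (area R).-integrable (hsq v) (EFin \o KH).
  exact: (@integrableS _ _ _ (area R) _ _ _ (measurable_domain Q) (measurable_hsq v)
    (hsq_domain Qv) divergence_integrable).
rewrite (integral_hsq_row (cKH Qv) iKH).
have lv : (v.1%:~R < (v.1 + 1)%:~R :> R)%R by rewrite ltr_int; lia.
pose q y := (K y * G ((v.1 + 1)%:~R, y) - K y * G (v.1%:~R, y))%R.
have Eq y : y \in `]v.2%:~R, (v.2 + 1)%:~R[ ->
    \int[mu]_(x in `[v.1%:~R, (v.1 + 1)%:~R]) (KH (x, y))%:E = (q y)%:E.
  move=> yv; have [_ yv2] := row_oo yv.
  have cGy := slice_x (cG Qv) yv2; have cHy := slice_x (cH Qv) yv2.
  have FTC : \int[mu]_(x in `[v.1%:~R, (v.1 + 1)%:~R]) (H (x, y))%:E =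
      (G ((v.1 + 1)%:~R, y) - G (v.1%:~R, y))%:E.
    apply: (FTC2_within lv cGy cHy) => x xv.
    apply: (dG (v := v) (z := (x, y)) Qv).
    by move: xv yv; rewrite /osq/= !in_itv/= => -> ->.
  rewrite /KH/q -mulrBr EFinM -FTC -integralZl//.
  exact: (within_integrable cHy).
have iL := within_integrable (cKG Qv (left_edge v.1)).
have iR := within_integrable (cKG Qv (right_edge v.1)).
transitivity (\int[mu]_(y in `]v.2%:~R, (v.2 + 1)%:~R[) (q y)%:E).
  by apply: eq_integral => y; rewrite inE/=; exact: Eq.
have mq : measurable_fun (`]v.2%:~R, (v.2 + 1)%:~R[%classic : set R) (fun y => (q y)%:E).
  have mL x : (v.1%:~R <= x <= (v.1 + 1)%:~R)%R ->
      measurable_fun (`]v.2%:~R, (v.2 + 1)%:~R[%classic : set R) (fun y => K y * G (x, y))%R.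
    move=> xv; apply/measurable_EFinP.
    apply: measurable_funS (within_measurable (cKG Qv xv)) => //.
    exact: subset_itv_oo_cc.
  apply/measurable_EFinP; apply: measurable_funB; apply: mL; [exact: right_edge|exact: left_edge].
rewrite -(integral_itv_bndoo true false mq).
rewrite (_ : (fun y => (q y)%:E) = (fun y => (K y * G ((v.1 + 1)%:~R, y))%:E -
    (K y * G (v.1%:~R, y))%:E)); last by apply/funext.
rewrite (integralB_EFin _ iR iL)//.
rewrite /e /shiftx/= -[RHS]EFinB.
by rewrite EFinB !fineK//; [exact: (E_fin Qv (left_edge v.1))|exact: (E_fin Qv (right_edge v.1))].
Qed.

Lemma divergence_bound :
  `| \int[area R]_(z in domain Q) (K z.2 * H z)%:E | <= T%:E * bd_dy Q G.
Proof.
have le1 v : Q v -> `|e v|%:E <= (T * C)%:E * S v.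
  by move=> Qv; exact: (E_le_S Qv (left_edge v.1)).
have le2 v : Q v -> `|e (shiftx v)|%:E <= (T * C)%:E * S v.
  by move=> Qv; exact: (E_le_S Qv (right_edge v.1)).
have TC0 := mulr_ge0 T0 C0.
apply: (le_trans (telescope divergence_integrable (sum_ZS TC0 le1) (sum_ZS TC0 le2) e_diff)).
have : \esum_(v in upward Q `|` downward Q) `|e v|%:E <=
    \esum_(v in upward Q `|` downward Q) (T%:E *
      L1norm v.2%:~R (v.2 + 1)%:~R (fun y => G (v.1%:~R, y))).
  (* A downward edge is the left side of its own square, an upward edge the right side of the square
     before it; G is continuous up to either side. *)
  apply: le_esum => v [[Qw _]|[Qv _]]; last exact: (E_le_T Qv (left_edge v.1)).
  have := E_le_T Qw (right_edge _); rewrite /= subrK; exact.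
move=> /le_trans; apply; apply: esumZ_le => // v _; exact: L1norm_ge0.
Qed.

End Divergence.

(** * Linear combinations of the derivatives in a jet *)

Section Combinations.
Context {R : realType}.
Local Notation mu := (@lebesgue_measure R).
Implicit Types (v : int * int) (x y : R) (Q : set (int * int)).
Implicit Types (g : nat -> R * R -> R) (s : seq (R * nat)).

(** A differential operator with constant coefficients, given by pairs (coefficient, order) and
    applied to the jet g. *)
Definition comb s g (z : R * R) : R := \sum_(ck <- s) ck.1 * g ck.2 z.

Lemma comb_nil g : comb [::] g = fun=> 0.
Proof. by apply/funext => z; rewrite /comb big_nil. Qed.

Lemma comb_cons c k s g :
  comb ((c, k) :: s) g = fun z => c * g k z + comb s g z.
Proof. by apply/funext => z; rewrite /comb big_cons. Qed.

Lemma within_continuousD (U : topologicalType) (A : set U) (q r : U -> R) :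
  {within A, continuous q} -> {within A, continuous r} ->
  {within A, continuous (fun t => q t + r t)}.
Proof.
move=> /subspace_continuousP cq /subspace_continuousP cr.
apply/subspace_continuousP => x Ax.
by apply: cvgD; [exact: cq|exact: cr].
Qed.

Lemma within_continuousZ (U : topologicalType) (A : set U) (c : R) (q : U -> R) :
  {within A, continuous q} -> {within A, continuous (fun t => c * q t)}.
Proof.
move=> cq; apply: within_continuousM cq; apply: continuous_subspaceT => x.
exact: cst_continuous.
Qed.

Lemma within_continuous_comb (A : set (R * R)) s g (P : pred nat) :
  (forall k, P k -> {within A, continuous (g k)}) -> all (fun ck => P ck.2) s ->
  {within A, continuous (comb s g)}.
Proof.
move=> cg; elim: s => [_|[c k] s IH /= /andP[Pk sP]].
  by rewrite comb_nil; apply: continuous_subspaceT => x; exact: cst_continuous.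
rewrite comb_cons; apply: within_continuousD (IH sP).
exact: (within_continuousZ (c := c) (cg k Pk)).
Qed.

Lemma L1norm_lin (a b c : R) (q r : R -> R) : {within `[a, b], continuous q} ->
  {within `[a, b], continuous r} ->
  (L1norm a b (fun x => (c * q x + r x)%R) <= `|c|%:E * L1norm a b q + L1norm a b r)%E.
Proof.
move=> cq cr; have ccq := within_continuousZ (c := c) cq.
rewrite -(L1normZ c cq) /L1norm -ge0_integralD//; last 2 first.
- exact: (within_measurable_norm ccq).
- exact: (within_measurable_norm cr).
apply: ge0_le_integral => //.
- exact: (within_measurable_norm (within_continuousD ccq cr)).
- apply: emeasurable_funD; [exact: (within_measurable_norm ccq)|
    exact: (within_measurable_norm cr)].
- by move=> x _; rewrite -EFinD lee_fin ler_normD.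
Qed.

(** On a jet this is differentiation; it turns the combination for B into the one for b. *)
Definition shift g (k : nat) := g k.+1.

Definition sumabs s : R := \sum_(ck <- s) `|ck.1|.

Lemma sumabs_ge0 s : 0 <= sumabs s.
Proof. exact: sumr_ge0. Qed.

Lemma comb_le s g (P : pred nat) (z : R * R) (M : \bar R) : (0 <= M)%E ->
  (forall k, P k -> (`|g k z|%:E <= M)%E) -> all (fun ck => P ck.2) s ->
  (`|comb s g z|%:E <= (sumabs s)%:E * M)%E.
Proof.
move=> M0 gM; elim: s => [_|[c k] s IH /= /andP[Pk sP]].
  by rewrite comb_nil normr0 /sumabs big_nil mul0e.
rewrite comb_cons /sumabs big_cons -/(sumabs s) EFinD ge0_muleDl ?lee_fin ?sumabs_ge0//.
apply: (@le_trans _ _ (`|c|%:E * `|g k z|%:E + `|comb s g z|%:E)%E).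
  by rewrite -EFinM -EFinD lee_fin -normrM ler_normD.
by apply: leeD (IH sP); apply: lee_wpmul2l; [rewrite lee_fin|exact: gM].
Qed.

Lemma rowL1_comb_le s g (P : pred nat) v y (M : \bar R) : (0 <= M)%E ->
  v.2%:~R <= y <= (v.2 + 1)%:~R ->
  (forall k, P k -> {within csq v, continuous (g k)}) ->
  (forall k, P k -> (rowL1 v (g k) y <= M)%E) -> all (fun ck => P ck.2) s ->
  (rowL1 v (comb s g) y <= (sumabs s)%:E * M)%E.
Proof.
move=> M0 yv cg gM; elim: s => [_|[c k] s IH /= /andP[Pk sP]].
  rewrite comb_nil /sumabs big_nil mul0e /rowL1 /L1norm integral0_eq//.
  by move=> x _; rewrite normr0.
rewrite comb_cons /sumabs big_cons -/(sumabs s) EFinD ge0_muleDl ?lee_fin ?sumabs_ge0//.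
have cc := within_continuous_comb cg sP.
apply: (le_trans (L1norm_lin c (slice_x (cg k Pk) yv) (slice_x cc yv))).
by apply: leeD (IH sP); apply: lee_wpmul2l; [rewrite lee_fin|exact: gM].
Qed.

Lemma is_derive_comb s g (P : pred nat) (z : R * R) :
  (forall k, P k -> is_derive z.1 1 (fun t => g k (t, z.2)) (g k.+1 z)) ->
  all (fun ck => P ck.2) s ->
  is_derive z.1 1 (fun t => comb s g (t, z.2)) (comb s (shift g) z).
Proof.
move=> dg; elim: s => [_|[c k] s IH /= /andP[Pk sP]].
  by rewrite !comb_nil; exact: is_derive_cst.
rewrite !comb_cons.
exact: (is_deriveD (is_deriveZ c (dg k Pk)) (IH sP)).
Qed.

Lemma edge_slice Q (h : R * R -> R) v :
  (forall v, Q v -> {within csq v, continuous h}) -> (upward Q `|` downward Q) v ->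
  {within `[v.2%:~R, (v.2 + 1)%:~R], continuous (fun y => h (v.1%:~R, y))}.
Proof.
move=> ch [[Qw _]|[Qv _]]; last exact: (slice_y (ch v Qv) (left_edge v.1)).
by have := slice_y (ch _ Qw) (right_edge _); rewrite /= subrK; exact.
Qed.

Lemma bd_dyE Q (h : R * R -> R) : bd_dy Q h =
  (\esum_(v in upward Q `|` downward Q)
     L1norm v.2%:~R (v.2 + 1)%:~R (fun y => h (v.1%:~R, y)))%E.
Proof. by []. Qed.

Lemma bd_dy_ge0 Q (h : R * R -> R) : (0 <= bd_dy Q h)%E.
Proof. by rewrite bd_dyE; apply: esum_ge0 => v _; exact: L1norm_ge0. Qed.

Lemma bd_dy_comb Q s g (P : pred nat) :
  (forall v k, Q v -> P k -> {within csq v, continuous (g k)}) ->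
  all (fun ck => P ck.2) s ->
  (bd_dy Q (comb s g) <= \sum_(ck <- s) `|ck.1|%:E * bd_dy Q (g ck.2))%E.
Proof.
move=> cg; elim: s => [_|[c k] s IH /= /andP[Pk sP]].
  rewrite comb_nil big_nil bd_dyE esum1// => v _.
  by rewrite /L1norm integral0_eq// => x _; rewrite normr0.
rewrite big_cons comb_cons; apply: le_trans (leeD (lexx _) (IH sP)).
rewrite !bd_dyE; apply: le_trans (leeD (esumZ_le (normr_ge0 c) _) (lexx _)); last first.
  by move=> v _; exact: L1norm_ge0.
rewrite -esumD; last 2 first.
- by move=> v _; rewrite mule_ge0 ?lee_fin// L1norm_ge0.
- by move=> v _; exact: L1norm_ge0.
apply: le_esum => v ev; apply: L1norm_lin.
- exact: (edge_slice (fun v Qv => cg v k Qv Pk) ev).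
- exact: (edge_slice (fun v Qv => within_continuous_comb (fun k => cg v k Qv) sP) ev).
Qed.

(** Orders below n in [s] become at most n after the shift, and [xjet_bound] covers exactly these:
    suprema below n, integrals up to n. *)
Lemma divergence_x Q n g s (K : R -> R) (T : R) : xjet Q n g ->
  all (fun ck => (ck.2 < n)%N) s -> continuous K -> (forall y, `|K y| <= T) ->
  (\int[area R]_(z in domain Q) `|g 0%N z|%:E < +oo)%E ->
  (\int[area R]_(z in domain Q) `|g n z|%:E < +oo)%E ->
  (area R).-integrable (domain Q) (EFin \o (fun z => K z.2 * comb s (shift g) z)) /\
  (`| \int[area R]_(z in domain Q) (K z.2 * comb s (shift g) z)%:E | <=
   T%:E * \sum_(ck <- s) `|ck.1|%:E * bd_dy Q (g ck.2))%E.
Proof.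
move=> jg sn cK KT f0 fn.
have T0 : 0 <= T by apply: le_trans (KT 0).
have [C C0 HC] := xjet_bound (R := R) n.
have SC0 : 0 <= sumabs s * C by rewrite mulr_ge0// sumabs_ge0.
have cg v k : Q v -> (k < n)%N -> {within csq v, continuous (g k)}.
  by move=> Qv kn; exact: (jg.1 v k Qv (ltnW kn)).
have cg' v k : Q v -> (k < n)%N -> {within csq v, continuous (shift g k)}.
  by move=> Qv kn; exact: (jg.1 v k.+1 Qv kn).
have cG v (Qv : Q v) := within_continuous_comb (fun k => cg v k Qv) sn.
have cH v (Qv : Q v) := within_continuous_comb (fun k => cg' v k Qv) sn.
have CW0 v y : (0 <= C%:E * rowW (g 0%N) (g n) v y)%E.
  by rewrite mule_ge0 ?lee_fin// rowW_ge0.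
have dG v z : Q v -> osq v z ->
    is_derive z.1 1 (fun t => comb s g (t, z.2)) (comb s (shift g) z).
  move=> Qv vz; exact: (is_derive_comb (fun k kn => jg.2 v k z Qv kn vz) sn).
have bG v x y : Q v -> y \in `]v.2%:~R, (v.2 + 1)%:~R[ ->
    v.1%:~R <= x <= (v.1 + 1)%:~R ->
    (`|comb s g (x, y)|%:E <= (sumabs s * C)%:E * rowW (g 0%N) (g n) v y)%E.
  move=> Qv yv xv; rewrite EFinM -muleA.
  exact: (comb_le (CW0 v y) (fun k kn => (HC Q g v y jg Qv yv k kn).1 x xv) sn).
have bH v y : Q v -> y \in `]v.2%:~R, (v.2 + 1)%:~R[ ->
    (rowL1 v (comb s (shift g)) y <= (sumabs s * C)%:E * rowW (g 0%N) (g n) v y)%E.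
  move=> Qv yv; rewrite EFinM -muleA; have [_ yv2] := row_oo yv.
  exact: (rowL1_comb_le (CW0 v y) yv2 (fun k => cg' v k Qv)
    (fun k kn => (HC Q g v y jg Qv yv k kn).2) sn).
have c0 v (Qv : Q v) := jg.1 v 0%N Qv (leq0n n).
have cn v (Qv : Q v) := jg.1 v n Qv (leqnn n).
split.
  exact: (divergence_integrable cK KT T0 SC0 cH c0 cn bH f0 fn).
apply: (le_trans (divergence_bound cK KT T0 SC0 cG cH c0 cn dG bG bH f0 fn)).
by apply: lee_wpmul2l; [rewrite lee_fin|exact: (bd_dy_comb cg sn)].
Qed.

End Combinations.

(** * Exchange of the coordinates, which carries the divergence bound over to the y-direction *)

Section Transposition.
Context {R : realType}.
Implicit Types (v : int * int) (Q : set (int * int)) (h : R * R -> R).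
Implicit Types (g : nat -> R * R -> R) (s : seq (R * nat)).

Definition tr (A : Type) (z : A * A) : A * A := (z.2, z.1).
Definition trset Q : set (int * int) := [set v | Q (tr v)].

Lemma csq_tr v (z : R * R) : csq (tr v) (tr z) <-> csq v z.
Proof. by rewrite /csq/= andbC. Qed.

Lemma osq_tr v (z : R * R) : osq (tr v) (tr z) <-> osq v z.
Proof. by rewrite /osq/= andbC. Qed.

Lemma domain_tr Q : (domain (trset Q) : set (R * R)) = [set z | domain Q (tr z)].
Proof.
apply/seteqP; split => [z [v Qv vz]|z [v Qv vz]]; exists (tr v) => //=.
- by move: vz; rewrite /= andbC.
- by rewrite /trset/= /tr/=; case: (v) Qv.
- by move: vz; rewrite /= andbC.
Qed.

Lemma within_continuous_tr v h : {within csq (tr v), continuous h} ->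
  {within csq v, continuous (h \o @tr R)}.
Proof.
move=> /subspace_continuousP ch; apply/subspace_continuousP => z vz.
have ct : @tr R @ nbhs z --> tr z.
  exact: (@swap_continuous R R z).
move=> B hB; have := ct _ (ch _ ((csq_tr v z).2 vz) B hB).
apply: (@filterS _ (nbhs z)) => w Hw vw; apply: Hw.
exact: ((csq_tr v w).2 vw).
Qed.

Definition yjet Q (n : nat) g : Prop :=
  (forall v k, Q v -> (k <= n)%N -> {within csq v, continuous (g k)}) /\
  (forall v k z, Q v -> (k < n)%N -> osq v z ->
     is_derive z.2 1 (fun t => g k (z.1, t)) (g k.+1 z)).

Lemma yjet_tr Q n g : yjet Q n g -> xjet (trset Q) n (fun k => g k \o @tr R).
Proof.
move=> [cg dg]; split => v k.
  by move=> Qv kn; apply: within_continuous_tr; exact: (cg (tr v) k Qv kn).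
move=> z Qv kn vz; exact: (dg (tr v) k (tr z) Qv kn ((osq_tr v z).2 vz)).
Qed.

(** Reflection in the diagonal makes leftward edges upward and rightward edges downward; absolute
    values do not see the reversed orientation. *)
Lemma bd_dy_tr Q h : bd_dy (trset Q) (h \o @tr R) = bd_dx Q h.
Proof.
rewrite /bd_dx /bd_dy (@reindex_esum _ _ _ (rightward Q `|` leftward Q) _ (@tr int))//.
split=> [[a b]|[a b] [c d] _ _ [-> ->]//|[a b]].
- by case=> [[Qv nQ]|[Qw nQ]]; [right|left].
- by case=> [[Qw nQ]|[Qv nQ]]; exists (b, a) => //; [right|left].
Qed.

Lemma divergence_y Q n g s (K : R -> R) (T : R) : yjet Q n g ->
  all (fun ck => (ck.2 < n)%N) s -> continuous K -> (forall y, `|K y| <= T) ->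
  (\int[area R]_(z in domain Q) `|g 0%N z|%:E < +oo)%E ->
  (\int[area R]_(z in domain Q) `|g n z|%:E < +oo)%E ->
  (area R).-integrable (domain Q) (EFin \o (fun z => K z.1 * comb s (shift g) z)) /\
  (`| \int[area R]_(z in domain Q) (K z.1 * comb s (shift g) z)%:E | <=
   T%:E * \sum_(ck <- s) `|ck.1|%:E * bd_dx Q (g ck.2))%E.
Proof.
move=> jg sn cK KT f0 fn.
have mD := measurable_domain (R := R) Q.
have mcont h : (forall v, Q v -> {within csq v, continuous h}) ->
    measurable_fun (domain Q) h.
  move=> ch; apply: measurable_fun_domain => v Qv.
  exact: (measurable_funS (measurable_csq v) (@hsq_csq _ v) (within_csq_measurable (ch v Qv))).
have normtr h : (forall v, Q v -> {within csq v, continuous h}) ->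
    (\int[area R]_(z in domain (trset Q)) `|(h \o @tr R) z|%:E =
     \int[area R]_(z in domain Q) `|h z|%:E)%E.
  move=> ch; rewrite domain_tr; apply: (ge0_integral_swap (f := fun z => `|h z|%:E) mD).
    by apply/measurable_EFinP; apply: measurableT_comp => //; exact: mcont.
  by move=> z _; rewrite lee_fin.
have c0 v (Qv : Q v) := jg.1 v 0%N Qv (leq0n n).
have cn v (Qv : Q v) := jg.1 v n Qv (leqnn n).
have f0' := f0; rewrite -(normtr _ c0) in f0'.
have fn' := fn; rewrite -(normtr _ cn) in fn'.
have [ix bx] := divergence_x (yjet_tr jg) sn cK KT f0' fn'.
pose F (z : R * R) := K z.1 * comb s (shift g) z.
have cF v : Q v -> {within csq v, continuous F}.
  move=> Qv; apply: within_continuousM.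
    apply: continuous_subspaceT => z.
    by apply: (@continuous_comp _ _ _ fst K z); [exact: cvg_fst|exact: cK].
  have cg' k : (k < n)%N -> {within csq v, continuous (shift g k)}.
    by move=> kn; exact: (jg.1 v k.+1 Qv kn).
  exact: (within_continuous_comb cg' sn).
have mF := mcont F cF.
have eF : (\int[area R]_(z in domain (trset Q)) ((F \o @tr R) z)%:E =
    \int[area R]_(z in domain Q) (F z)%:E)%E.
  rewrite domain_tr; apply: (integral_swap (f := fun z => (F z)%:E) mD).
  exact/measurable_EFinP.
split.
  apply/integrableP; split; first exact/measurable_EFinP.
  have [_] := integrableP _ _ _ ix.
  by have := normtr F cF; rewrite /= => ->.
move: bx; under eq_bigr do rewrite bd_dy_tr.
by rewrite -/F -eF.
Qed.

End Transposition.

(** * Estimate of the remainder *)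

Section Assembly.
Context {R : realType}.
Implicit Types (Q : set (int * int)) (f h u : R * R -> R).

Lemma bounded_mul Q h u (c : R) : 0 <= c -> measurable_fun (domain Q) h ->
  measurable_fun (domain Q) u -> (forall z, `|h z| <= c) ->
  (\int[area R]_(z in domain Q) `|u z|%:E < +oo)%E ->
  (area R).-integrable (domain Q) (EFin \o (fun z => h z * u z)) /\
  (`| \int[area R]_(z in domain Q) (h z * u z)%:E | <=
   c%:E * \int[area R]_(z in domain Q) `|u z|%:E)%E.
Proof.
move=> c0 mh mu hc fu; have mD := measurable_domain (R := R) Q.
have mhu : measurable_fun (domain Q) (fun z => (h z * u z)%:E).
  by apply/measurable_EFinP; exact: measurable_funM.
have mN : measurable_fun (domain Q) (fun z => `|u z|%:E).
  by apply/measurable_EFinP; apply: measurableT_comp.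
have le : (\int[area R]_(z in domain Q) `|(h z * u z)%:E| <=
    c%:E * \int[area R]_(z in domain Q) `|u z|%:E)%E.
  rewrite -ge0_integralZl_EFin//.
  apply: ge0_le_integral => //.
  - exact: measurableT_comp.
  - exact: measurable_funeM.
  - by move=> z _; rewrite /= -EFinM lee_fin normrM ler_wpM2r.
split; last exact: le_trans (le_abse_integral (area R) mD mhu) le.
apply/integrableP; split; first exact: mhu.
by apply: (le_lt_trans le); apply: lte_mul_pinfty.
Qed.

Lemma Ck_pderiv (D : set (R * R)) n mu nu f : Ck_closure D n f -> (mu + nu <= n)%N ->
  Ck_closure D (n - (mu + nu)) (pderiv D mu nu f).
Proof.
move=> Hf mn; rewrite /pderiv; apply: Ck_iter_pdx; apply: Ck_iter_pdy.
by apply: Ck_le Hf; lia.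
Qed.

Lemma xjet_Ck Q n h : Ck_closure (domain Q) n h ->
  xjet Q n (fun k => iter k (pdx (domain Q)) h).
Proof.
move=> Hh; split => v k.
  move=> Qv kn; have := Ck_continuous (Ck_iter_pdx (k := 0%N) (Ck_le _ Hh)).
  move=> /(_ k); rewrite addn0 => /(_ kn).
  exact: (continuous_subspaceW (csq_closure Qv)).
move=> z Qv kn vz; apply: (is_derive_pdx (k := 0%N)).
  by apply: Ck_iter_pdx; apply: Ck_le Hh; rewrite addn1.
exact: (osq_interior Qv vz).
Qed.

Lemma yjet_Ck Q n h : Ck_closure (domain Q) n h ->
  yjet Q n (fun k => iter k (pdy (domain Q)) h).
Proof.
move=> Hh; split => v k.
  move=> Qv kn; have := Ck_continuous (Ck_iter_pdy (k := 0%N) (Ck_le _ Hh)).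
  move=> /(_ k); rewrite addn0 => /(_ kn).
  exact: (continuous_subspaceW (csq_closure Qv)).
move=> z Qv kn vz; apply: (is_derive_pdy (k := 0%N)).
  by apply: Ck_iter_pdy; apply: Ck_le Hh; rewrite addn1.
exact: (osq_interior Qv vz).
Qed.

(* B_{n,p} as a list of pairs (coefficient, order of the derivative). *)
Definition Bcoef (n p : nat) : seq (R * nat) :=
  (- 2^-1, 0%N) ::
  [seq ((-1) ^+ r.+1 * Tcoef r.*2 p, r.*2.-1) | r <- index_iota 1 n./2.+1].

Lemma Bcoef_lt (n p : nat) : (0 < n)%N -> all (fun ck => (ck.2 < n)%N) (Bcoef n p).
Proof.
move=> n0; rewrite /= n0 all_map; apply/allP => r; rewrite mem_index_iota /=.
have := odd_double_half n; lia.
Qed.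

(** Since b is the derivative of B, its orders are those of [Bcoef] raised by one; for r >= 1 the
    successor of [r.*2.-1] is indeed 2r. *)
Lemma opb_comb (d : (R * R -> R) -> R * R -> R) (n p : nat) (g : R * R -> R) z :
  opb d n p g z = comb (Bcoef n p) (shift (fun k => iter k d g)) z.
Proof.
rewrite /opb /comb /Bcoef big_cons big_map /shift; congr (_ + _).
rewrite !big_nat; apply: eq_bigr => -[//|r] _ /=.
by rewrite doubleS.
Qed.

(** The alternating signs disappear in the absolute values and T_{2r,p} is positive; this produces
    the weights of the boundary terms. *)
Lemma Bcoef_sum (n p : nat) (b : nat -> \bar R) : (forall k, 0 <= b k)%E ->
  (\sum_(ck <- Bcoef n p) `|ck.1|%:E * b ck.2 =
   (2^-1)%:E * b 0%N + \sum_(1 <= r < n./2.+1) (Tcoef r.*2 p)%:E * b r.*2.-1)%E.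
Proof.
move=> b0; rewrite /Bcoef big_cons big_map /= normrN gtr0_norm ?invr_gt0//.
congr (_ + _)%E; rewrite !big_nat; apply: eq_bigr => r /andP[r1 _].
rewrite normrM normrX normrN1 expr1n mul1r ger0_norm//.
by apply/ltW/Tcoef_gt0; lia.
Qed.

Lemma measurable_csq_domain Q h : (forall v, Q v -> {within csq v, continuous h}) ->
  measurable_fun (domain Q) h.
Proof.
move=> ch; apply: measurable_fun_domain => v Qv.
exact: (measurable_funS (measurable_csq v) (@hsq_csq _ v) (within_csq_measurable (ch v Qv))).
Qed.

Variables (Q : set (int * int)) (n n' p p' : nat) (f : R * R -> R).
Hypotheses (hn : (1 < n)%N) (hn' : (1 < n')%N).
Hypothesis hf : Ck_closure (domain Q) (n + n') f.

Let D : set (R * R) := domain Q.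
Let F mu nu := pderiv D mu nu f.
Let Kx (x : R) : R := (-1) ^+ n * ckernel n p x.
Let Ky (y : R) : R := (-1) ^+ n' * ckernel n' p' y.

Lemma Ck_F mu nu : (mu + nu <= n + n')%N -> Ck_closure D (n + n' - (mu + nu)) (F mu nu).
Proof. exact: Ck_pderiv. Qed.

Lemma within_continuous_F mu nu v : (mu + nu <= n + n')%N -> Q v ->
  {within csq v, continuous (F mu nu)}.
Proof.
move=> mn Qv; apply: (continuous_subspaceW (csq_closure Qv)).
exact: (Ck_continuous (Ck_F mn)).
Qed.

Lemma measurable_F mu nu : (mu + nu <= n + n')%N -> measurable_fun D (F mu nu).
Proof.
by move=> mn; apply: measurable_csq_domain => v Qv; exact: within_continuous_F.
Qed.

(** In [pderiv] the x-derivatives are outermost, so that jets in x arise directly, whereas jets in y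
    require this exchange. *)
Lemma F_pdy nu : (nu <= n')%N -> F n nu = iter nu (pdy D) (iter n (pdx D) f).
Proof.
move=> nn; apply: iter_pdx_pdy; apply: Ck_le hf; lia.
Qed.

Lemma continuous_Kx : continuous Kx.
Proof.
move=> x; apply: cvgM; first exact: cvg_cst.
exact: continuous_ckernel.
Qed.

Lemma continuous_Ky : continuous Ky.
Proof.
move=> x; apply: cvgM; first exact: cvg_cst.
exact: continuous_ckernel.
Qed.

Lemma Kx_le x : `|Kx x| <= Tcoef n p.
Proof. by rewrite normrM normrX normrN1 expr1n mul1r ckernel_le. Qed.

Lemma Ky_le y : `|Ky y| <= Tcoef n' p'.
Proof. by rewrite normrM normrX normrN1 expr1n mul1r ckernel_le. Qed.

Lemma integrand_rearrange (a k u b a' k' u' b' w c c' e : R) :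
  c = b -> c' = b' -> e = k * w ->
  a * (k * u) + c + (a' * (k' * u') + c') + k' * e =
  a * k * u + (b + (a' * k' * u' + (b' + k' * k * w))).
Proof. by move=> -> -> ->; ring. Qed.

Lemma Ck_F0n' : Ck_closure D n (F 0 n').
Proof. by apply: Ck_le (Ck_F (mu := 0%N) (nu := n') _); lia. Qed.

Lemma Ck_Fn0 : Ck_closure D n' (F n 0).
Proof. by apply: Ck_le (Ck_F (mu := n) (nu := 0%N) _); lia. Qed.

Lemma xjet_F : xjet Q n (fun k => F k n').
Proof. exact: (xjet_Ck Ck_F0n'). Qed.

Lemma yjet_F : yjet Q n' (fun k => F n k).
Proof.
have [cy dy] := yjet_Ck Ck_Fn0; split => v k.
  by move=> Qv kn; rewrite (F_pdy kn); exact: (cy v k Qv kn).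
move=> z Qv kn vz; rewrite (F_pdy (ltnW kn)) (F_pdy kn); exact: (dy v k z Qv kn vz).
Qed.

(** Each kernel passes through derivatives in the other variable. What remains are three products of
    a bounded kernel with a derivative of f, and two terms in divergence form. *)
Lemma R_integrandE z : D z -> R_integrand Q n p n' p' f z =
  (akernel p z.1 * Ky z.2) * F 0 n' z +
  (Ky z.2 * comb (Bcoef n p) (shift (fun k => F k n')) z +
  ((akernel p' z.2 * Kx z.1) * F n 0 z +
  (Kx z.1 * comb (Bcoef n' p') (shift (fun k => F n k)) z +
  (Kx z.1 * Ky z.2) * F n n' z))).
Proof.
move=> Dz.
have Hy := Ck_F0n'; have Hx := Ck_Fn0.
have Ex k : (k <= n)%N -> iter k (pdx D) (fun w => Ky w.2 * F 0 n' w) z = Ky z.2 * F k n' z.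
  move=> kn; exact: (iter_pdx_mul continuous_Ky Hy kn Dz).
have Ey k : (k <= n')%N -> iter k (pdy D) (fun w => Kx w.1 * F n 0 w) z = Kx z.1 * F n k z.
  move=> kn; rewrite (F_pdy kn); exact: (iter_pdy_mul continuous_Kx Hx kn Dz).
have Bx : opb (pdx D) n p (fun w => Ky w.2 * F 0 n' w) z =
    Ky z.2 * comb (Bcoef n p) (shift (fun k => F k n')) z.
  rewrite opb_comb /comb mulr_sumr !big_seq; apply: eq_bigr => ck cks.
  have kn : (ck.2.+1 <= n)%N by have /allP/(_ _ cks) := Bcoef_lt p (ltnW hn).
  by rewrite /shift (Ex _ kn) mulrCA.
have By : opb (pdy D) n' p' (fun w => Kx w.1 * F n 0 w) z =
    Kx z.1 * comb (Bcoef n' p') (shift (fun k => F n k)) z.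
  rewrite opb_comb /comb mulr_sumr !big_seq; apply: eq_bigr => ck cks.
  have kn : (ck.2.+1 <= n')%N by have /allP/(_ _ cks) := Bcoef_lt p' (ltnW hn').
  by rewrite /shift (Ey _ kn) mulrCA.
rewrite [LHS](_ : _ = akernel p z.1 * (Ky z.2 * F 0 n' z) +
   opb (pdx D) n p (fun w => Ky w.2 * F 0 n' w) z +
   (akernel p' z.2 * (Kx z.1 * F n 0 z) +
    opb (pdy D) n' p' (fun w => Kx w.1 * F n 0 w) z) +
   Kx z.1 * iter n (pdx D) (fun w => Ky w.2 * F 0 n' w) z); last by [].
exact: (integrand_rearrange (akernel p z.1) (F 0 n' z) (akernel p' z.2) (Kx z.1)
  (F n 0 z) Bx By (Ex n (leqnn n))).
Qed.

Local Open Scope ereal_scope.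
Let abs_area (g : R * R -> R) := \int[area R]_(z in D) `|g z|%:E.
Let T s q : \bar R := (Tcoef s q)%:E.

Lemma abs_area_ge0 g : 0 <= abs_area g.
Proof. by apply: integral_ge0 => z _; rewrite lee_fin. Qed.

Lemma T_ge0 s q : (1 < s)%N -> 0 <= T s q.
Proof. by move=> s1; rewrite lee_fin; apply/ltW/Tcoef_gt0. Qed.

Lemma bd_dx_ge0 (g : R * R -> R) : 0 <= bd_dx Q g.
Proof. by apply: esum_ge0 => v _; exact: L1norm_ge0. Qed.

Lemma sum_T_ge0 (m q : nat) (b : nat -> \bar R) : (forall k, 0 <= b k) ->
  0 <= \sum_(1 <= r < m) T r.*2 q * b r.*2.-1.
Proof.
move=> b0; rewrite big_nat; apply: sume_ge0 => -[//|r] _.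
by rewrite mule_ge0// T_ge0// doubleS.
Qed.

Lemma abse_integral5 (t1 t2 t3 t4 t5 : R * R -> R) (b1 b2 b3 b4 b5 : \bar R) :
  let I t b := (area R).-integrable D (EFin \o t) /\
    `| \int[area R]_(z in D) (t z)%:E | <= b in
  I t1 b1 -> I t2 b2 -> I t3 b3 -> I t4 b4 -> I t5 b5 ->
  `| \int[area R]_(z in D) (t1 z + (t2 z + (t3 z + (t4 z + t5 z))))%:E | <=
  b1 + (b2 + (b3 + (b4 + b5))).
Proof.
move=> I; have mD := measurable_domain (R := R) Q.
have ID t u a b : I t a -> I u b -> I (fun z => t z + u z)%R (a + b).
  move=> [it ta] [iu ub]; split.
    exact: (@integrableD _ _ _ (area R) D mD _ _ it iu).
  have -> : \int[area R]_(z in D) (t z + u z)%:E =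
      \int[area R]_(z in D) (t z)%:E + \int[area R]_(z in D) (u z)%:E.
    exact: (@integralD _ _ _ (area R) D mD _ _ it iu).
  by apply: le_trans (lee_abs_add _ _) _; exact: leeD.
move=> I1 I2 I3 I4 I5.
exact: (ID _ _ _ _ I1 (ID _ _ _ _ I2 (ID _ _ _ _ I3 (ID _ _ _ _ I4 I5)))).2.
Qed.

(** In the extended reals distributivity needs sign conditions, which the nonnegativity hypotheses
    supply; the rest is reordering. *)
Lemma bound_rearrange (t t' m m' : R) (a b c d e x y : \bar R) :
  (0 <= t)%R -> (0 <= t')%R ->
  0 <= (m%:E * a) -> 0 <= (m'%:E * b) -> 0 <= c -> 0 <= d -> 0 <= x -> 0 <= y ->
  (m * t')%:E * a + (t'%:E * (c + y) + ((m' * t)%:E * b +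
    (t%:E * (d + x) + (t * t')%:E * e))) =
  t%:E * (m'%:E * b + d) + t'%:E * (m%:E * a + c) + t%:E * x + t'%:E * y +
    t%:E * t'%:E * e.
Proof.
move=> t0 t0' a0 b0 c0 d0 x0 y0.
rewrite !ge0_muleDr// !EFinM [m%:E * t'%:E]muleC [m'%:E * t%:E]muleC !muleA -!addeA.
set P1 := t'%:E * m%:E * a; set P2 := t'%:E * c; set P3 := t'%:E * y.
set P4 := t%:E * m'%:E * b; set P5 := t%:E * d; set P6 := t%:E * x; set P7 := _ * e.
rewrite [in RHS](addeCA P5 P1) [in RHS](addeCA P4 P1) [in RHS](addeCA P5 P2).
by rewrite [in RHS](addeCA P4 P2) [in RHS](addeCA P6 P3) [in RHS](addeCA P5 P3) [in RHS](addeCA P4 P3).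
Qed.

Lemma remainder_le_finite : abs_area (F 0 n') < +oo -> abs_area (F n 0) < +oo ->
  abs_area (F n n') < +oo ->
  `| remainder Q n p n' p' f | <= remainder_bound Q n p n' p' f.
Proof.
move=> f0 fn fnn.
have T0 : (0 <= Tcoef n p :> R)%R by apply/ltW/Tcoef_gt0.
have T0' : (0 <= Tcoef n' p' :> R)%R by apply/ltW/Tcoef_gt0.
have mKx : measurable_fun D (fun z => Kx z.1).
  apply: measurable_funTS; apply: (measurableT_comp _ measurable_fst).
  exact: (continuous_measurable_fun continuous_Kx).
have mKy : measurable_fun D (fun z => Ky z.2).
  apply: measurable_funTS; apply: (measurableT_comp _ measurable_snd).
  exact: (continuous_measurable_fun continuous_Ky).
have mAx : measurable_fun D (fun z : R * R => akernel p z.1).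
  by apply: measurable_funTS; apply: (measurableT_comp _ measurable_fst); exact: measurable_akernel.
have mAy : measurable_fun D (fun z : R * R => akernel p' z.2).
  by apply: measurable_funTS; apply: (measurableT_comp _ measurable_snd); exact: measurable_akernel.
have b1 z : (`|akernel p z.1 * Ky z.2| <= (p.*2.+1)%:R * Tcoef n' p')%R.
  by rewrite normrM; apply: ler_pM => //; [exact: akernel_le|exact: Ky_le].
have b3 z : (`|akernel p' z.2 * Kx z.1| <= (p'.*2.+1)%:R * Tcoef n p)%R.
  by rewrite normrM; apply: ler_pM => //; [exact: akernel_le|exact: Kx_le].
have b5 z : (`|Kx z.1 * Ky z.2| <= Tcoef n p * Tcoef n' p')%R.
  by rewrite normrM; apply: ler_pM => //; [exact: Kx_le|exact: Ky_le].
have n0 : (n + 0 <= n + n')%N by rewrite leq_add2l.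
have I1 := bounded_mul (h := fun z => (akernel p z.1 * Ky z.2)%R) (mulr_ge0 (ler0n _ _) T0')
  (measurable_funM mAx mKy) (measurable_F (mu := 0%N) (nu := n') (leq_addl _ _)) b1 f0.
have I3 := bounded_mul (h := fun z => (akernel p' z.2 * Kx z.1)%R) (mulr_ge0 (ler0n _ _) T0)
  (measurable_funM mAy mKx) (measurable_F n0) b3 fn.
have I5 := bounded_mul (h := fun z => (Kx z.1 * Ky z.2)%R) (mulr_ge0 T0 T0')
  (measurable_funM mKx mKy) (measurable_F (leqnn _)) b5 fnn.
have I2 := divergence_x xjet_F (Bcoef_lt p (ltnW hn)) continuous_Ky Ky_le f0 fnn.
have I4 := divergence_y yjet_F (Bcoef_lt p' (ltnW hn')) continuous_Kx Kx_le fn fnn.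
have -> : remainder Q n p n' p' f = \int[area R]_(z in D)
    ((akernel p z.1 * Ky z.2) * F 0 n' z +
    (Ky z.2 * comb (Bcoef n p) (shift (fun k => F k n')) z +
    ((akernel p' z.2 * Kx z.1) * F n 0 z +
    (Kx z.1 * comb (Bcoef n' p') (shift (fun k => F n k)) z +
    (Kx z.1 * Ky z.2) * F n n' z))))%:E.
  by apply: eq_integral => z; rewrite inE => Dz; rewrite R_integrandE.
apply: (le_trans (abse_integral5 I1 I2 I3 I4 I5)).
rewrite (Bcoef_sum _ _ (fun k => bd_dy_ge0 Q (F k n'))).
rewrite (Bcoef_sum _ _ (fun k => bd_dx_ge0 (F n k))).
rewrite (bound_rearrange _ T0 T0')//; try exact: abs_area_ge0.
- by rewrite mule_ge0 ?lee_fin ?abs_area_ge0.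
- by rewrite mule_ge0 ?lee_fin ?abs_area_ge0.
- by rewrite mule_ge0 ?lee_fin ?bd_dy_ge0.
- by rewrite mule_ge0 ?lee_fin ?bd_dx_ge0.
- exact: (sum_T_ge0 _ _ (fun k => bd_dx_ge0 (F n k))).
- exact: (sum_T_ge0 _ _ (fun k => bd_dy_ge0 Q (F k n'))).
Qed.

(** Each of the three area integrals has a strictly positive factor in the bound and all terms are
    nonnegative, so neither 0 times [+oo] nor a cancellation with [-oo] can occur. *)
Lemma remainder_bound_infinite :
  [\/ abs_area (F 0 n') = +oo, abs_area (F n 0) = +oo | abs_area (F n n') = +oo] ->
  remainder_bound Q n p n' p' f = +oo.
Proof.
move=> hoo; have T1 : 0 < T n p by rewrite lte_fin; exact: Tcoef_gt0.
have T2 : 0 < T n' p' by rewrite lte_fin; exact: Tcoef_gt0.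
rewrite /remainder_bound -/D.
set X1 := (X in X + _ + _ + _ + _); set X2 := (X in _ + X + _ + _ + _).
set X3 := (X in _ + _ + X + _ + _); set X4 := (X in _ + _ + _ + X + _).
set X5 := (X in _ + _ + _ + _ + X).
have X10 : 0 <= X1.
  by rewrite mule_ge0 ?(ltW T1)// adde_ge0// mule_ge0 ?lee_fin ?abs_area_ge0 ?bd_dx_ge0.
have X20 : 0 <= X2.
  by rewrite mule_ge0 ?(ltW T2)// adde_ge0// mule_ge0 ?lee_fin ?abs_area_ge0 ?bd_dy_ge0.
have X30 : 0 <= X3.
  by rewrite mule_ge0 ?(ltW T1)//; exact: (sum_T_ge0 _ _ (fun k => bd_dx_ge0 (F n k))).
have X40 : 0 <= X4.
  by rewrite mule_ge0 ?(ltW T2)//; exact: (sum_T_ge0 _ _ (fun k => bd_dy_ge0 Q (F k n'))).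
have X50 : 0 <= X5 by rewrite mule_ge0 ?abs_area_ge0// mule_ge0 ?(ltW T1) ?(ltW T2).
have pinfty (y : \bar R) : 0 <= y -> y != -oo by move=> y0; rewrite gt_eqF// (lt_le_trans _ y0).
suff [->|[->|->]] : X1 = +oo \/ X2 = +oo \/ X5 = +oo.
- by rewrite !addye// pinfty.
- by rewrite addey ?pinfty// !addye// pinfty.
- by rewrite addey// pinfty// !adde_ge0.
case: hoo => E.
- right; left; rewrite /X2 -/(abs_area (F 0 n')) E gt0_muley ?lte_fin// addye.
    by rewrite gt0_muley.
  by rewrite pinfty// mule_ge0 ?lee_fin ?bd_dy_ge0.
- left; rewrite /X1 -/(abs_area (F n 0)) E gt0_muley ?lte_fin// addye.
    by rewrite gt0_muley.
  by rewrite pinfty// mule_ge0 ?lee_fin ?bd_dx_ge0.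
- by right; right; rewrite /X5 -/(abs_area (F n n')) E gt0_muley// mule_gt0.
Qed.

Lemma remainder_le : `| remainder Q n p n' p' f | <= remainder_bound Q n p n' p' f.
Proof.
have [f0|f0] := ltP (abs_area (F 0 n')) +oo; last first.
  by rewrite remainder_bound_infinite ?leey//; apply: Or31; apply/eqP; rewrite -leye_eq.
have [fn|fn] := ltP (abs_area (F n 0)) +oo; last first.
  by rewrite remainder_bound_infinite ?leey//; apply: Or32; apply/eqP; rewrite -leye_eq.
have [fnn|fnn] := ltP (abs_area (F n n')) +oo; last first.
  by rewrite remainder_bound_infinite ?leey//; apply: Or33; apply/eqP; rewrite -leye_eq.
exact: remainder_le_finite.
Qed.

End Assembly.

Unset Implicit Arguments.

Theorem theorem4 (R : realType) (P P0 : set (int * int))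
  (n n' p p' : nat) (f : R * R -> R)
  (P1 := P `\` P0) (D := domain P1 : set (R * R))
  (hP0 : P0 `<=` P) (hn : (1 < n)%N) (hn' : (1 < n')%N)
  (hf : Ck_closure D (n + n') f)
  (hsumP : summable P (fun v => (f (pt v))%:E))
  (hsumP0 : summable P0 (fun v => (f (pt v))%:E))
  (hA : (area R).-integrable D (EFin \o A_integrand p p' f))
  (hLx : (bd_dx P1 (L_dx P1 p n' p' f) < +oo)%E)
  (hLy : (bd_dy P1 (L_dy P1 n p p' f) < +oo)%E)
  (hV : summable (vertices P1) (fun v => (V_summand P1 n p n' p' f v)%:E))
  (hR : (area R).-integrable D (EFin \o R_integrand P1 n p n' p' f)) :
  (`| remainder P1 n p n' p' f | <= remainder_bound P1 n p n' p' f)%E.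
Proof. exact: remainder_le hn hn' hf. Qed.
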